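(* Let $(G,\rho)$ be a unimodular random rooted graph and $\xi$ a percolation of $(G,\rho)$ such that every vertex of the subgraph $G_D:=G[\xi]$ has degree at most $D$, for some positive integer $D$. Then for every $\alpha>0$ there exists a site percolation $\omega_\alpha$ of $(G,\rho,\xi)$ (i.e. $(G,\rho,\xi,\omega_\alpha)$ is unimodular) with rate at most $\alpha$ such that, almost surely, every infinite connected component of $G_D[\omega_\alpha]$ has inner vertex-expansion constant at least $\alpha$.
   Context: A random rooted graph $(G,\rho)$ (root in a connected locally finite graph) is unimodular if for every Borel $f\ge0$ on doubly rooted graphs (possibly with marks), $\mathbb E[\sum_o f(G,\rho,o)]=\mathbb E[\sum_o f(G,o,\rho)]$. A marking is a random function from $V(G)\cup E(G)$ to a Polish space such that the marked rooted graph is unimodular. A percolation is a $\{0,1\}$-marking in which an edge is open (value 1) only if both endpoints are open; a site percolation additionally has every edge with both endpoints open being open. $G[\omega]$ denotes the subgraph of open vertices and edges; the rate of $\omega$ is $\mathbb P[\omega(\rho)=0]$. For a graph $G$ and finite $K\subseteq V(G)$, $\partial_{\mathrm{in}}K$ is the set of vertices of $K$ adjacent to some vertex outside $K$; the inner vertex-expansion constant of $G$ is $\inf\{|\partial_{\mathrm{in}}K|/|K|:\emptyset\ne K\subseteq V(G)\text{ finite}\}$. *)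

(* Defs.v *)
From HB Require Import structures.
From mathcomp Require Import all_boot all_order all_algebra.
From mathcomp Require Import all_classical all_reals all_analysis measurable_realfun.
Set Implicit Arguments. Unset Strict Implicit. Unset Printing Implicit Defensive.
Import Order.TTheory GRing.Theory Num.Theory.
Local Open Scope classical_set_scope.
Local Open Scope ring_scope.

(* A connected locally finite graph is countable, so every rooted graph has *)
(* a representative with vertex set lV ⊆ nat.  The marks are lvm (vertices) *)
(* and lem (edges; only its values on edges, which are symmetric, matter).  *)
Record lgraph (M : Type) := LGraph {
  lV : nat -> bool;
  ladj : nat -> nat -> bool;
  lvm : nat -> M;
  lem : nat -> nat -> M
}.

Section lgraph_pointed.
Variable M : pointedType.
HB.instance Definition _ := gen_eqMixin (lgraph M).
HB.instance Definition _ := gen_choiceMixin (lgraph M).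
HB.instance Definition _ := isPointed.Build (lgraph M)
  (LGraph (fun _ => false) (fun _ _ => false) (fun _ => point) (fun _ _ => point)).
End lgraph_pointed.

Definition lcyl (M : Type) : set (set (lgraph M)) :=
  [set A | (exists i b, A = [set g | lV g i = b])
        \/ (exists i j b, A = [set g | ladj g i j = b])
        \/ (exists i m, A = [set g | lvm g i = m])
        \/ (exists i j m, A = [set g | lem g i j = m])].

Definition lgraphM (M : pointedType) := g_sigma_algebraType (@lcyl M).

Definition reach (e : rel nat) (u v : nat) : Prop :=
  exists p : seq nat, path e u p /\ last u p = v.

Definition wf_rooted (M : Type) (g : lgraph M) (r : nat) : Prop :=
  lV g r /\
  (forall u v, ladj g u v -> lV g u && lV g v) /\
  (forall u v, ladj g u v = ladj g v u) /\
  (forall u, ~~ ladj g u u) /\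
  (forall u v, ladj g u v -> lem g u v = lem g v u) /\
  (forall u, exists n, forall v, ladj g u v -> (v < n)%N) /\
  (forall v, lV g v -> reach (ladj g) r v).

Definition liso (M : Type) (g1 g2 : lgraph M) (pi : nat -> nat) : Prop :=
  (forall u, lV g1 u -> lV g2 (pi u)) /\
  (forall u v, lV g1 u -> lV g1 v -> pi u = pi v -> u = v) /\
  (forall w, lV g2 w -> exists u, lV g1 u /\ pi u = w) /\
  (forall u v, lV g1 u -> lV g1 v -> ladj g2 (pi u) (pi v) = ladj g1 u v) /\
  (forall u, lV g1 u -> lvm g2 (pi u) = lvm g1 u) /\
  (forall u v, ladj g1 u v -> lem g2 (pi u) (pi v) = lem g1 u v).

(* Nonnegative Borel functions on doubly rooted marked graphs, i.e.         *)
(* isomorphism-invariant measurable functions of (g, root, other vertex).   *)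
Definition test_fn (R : realType) (M : pointedType)
  (f : lgraphM M -> nat -> nat -> \bar R) : Prop :=
  [/\ (forall r o, measurable_fun setT (fun g => f g r o)),
      (forall g r o, (0 <= f g r o)%E) &
      (forall g1 g2 pi r o, lV g1 r -> lV g1 o -> liso g1 g2 pi ->
          f g1 r o = f g2 (pi r) (pi o))].

Definition random_rooted d (Omega : measurableType d)
  (M : pointedType) (X : Omega -> lgraphM M) (rho : Omega -> nat) : Prop :=
  [/\ measurable_fun setT X,
      (forall n, measurable [set w | rho w = n]) &
      (forall w, wf_rooted (X w) (rho w))].

Local Open Scope ereal_scope.

Definition unimodular (R : realType) d (Omega : measurableType d)
  (P : probability Omega R) (M : pointedType)
  (X : Omega -> lgraphM M) (rho : Omega -> nat) : Prop :=
  forall f, test_fn f ->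
    \int[P]_w (\sum_(o <oo | lV (X w) o) f (X w) (rho w) o)
    = \int[P]_w (\sum_(o <oo | lV (X w) o) f (X w) o (rho w)).

(* Equality in law of two random rooted marked graphs (laws on the space    *)
(* of isomorphism classes of rooted marked graphs).                          *)
Definition same_law (R : realType) d (Omega : measurableType d)
  (P : probability Omega R) d' (Omega' : measurableType d')
  (P' : probability Omega' R) (M : pointedType)
  (X : Omega -> lgraphM M) (rho : Omega -> nat)
  (X' : Omega' -> lgraphM M) (rho' : Omega' -> nat) : Prop :=
  forall f, test_fn f ->
    \int[P]_w f (X w) (rho w) (rho w) = \int[P']_w f (X' w) (rho' w) (rho' w).

Local Close Scope ereal_scope.

Definition proj1_marks (A B : Type) (g : lgraph (A * B)) : lgraph A :=
  LGraph (lV g) (ladj g) (fun v => (lvm g v).1) (fun u v => (lem g u v).1).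

Definition is_percolation (g : lgraph bool) : Prop :=
  forall u v, ladj g u v -> lem g u v -> lvm g u && lvm g v.

Definition perc_deg_le (g : lgraph bool) (D : nat) : Prop :=
  forall v, lV g v -> lvm g v ->
    forall s : seq nat, uniq s -> all (fun u => ladj g v u && lem g v u) s ->
      (size s <= D)%N.

Definition is_site_percolation2 (g : lgraph (bool * bool)) : Prop :=
  forall u v, ladj g u v -> (lem g u v).2 = (lvm g u).2 && (lvm g v).2.

(* The graph G_D[omega]: vertices/edges open for both xi and omega. *)
Definition Hv (g : lgraph (bool * bool)) (v : nat) : bool :=
  [&& lV g v, (lvm g v).1 & (lvm g v).2].
Definition He (g : lgraph (bool * bool)) : rel nat :=
  fun u v => [&& Hv g u, Hv g v, ladj g u v, (lem g u v).1 & (lem g u v).2].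

Definition Hcomp (g : lgraph (bool * bool)) (v : nat) : set nat :=
  [set w | Hv g v /\ reach (He g) v w].

Definition inner_expansion_ge (R : realType) (g : lgraph (bool * bool))
  (C : set nat) (a : R) : Prop :=
  forall K : seq nat, uniq K -> K != [::] -> (forall u, u \in K -> C u) ->
    a <= (count (fun u => `[< exists w, C w /\ w \notin K /\ He g u w >]) K)%:R
         / (size K)%:R.

(* Main.v *)
Require Import Defs.
From HB Require Import structures.
From mathcomp Require Import all_boot all_order all_algebra.
From mathcomp Require Import all_classical all_reals all_analysis measurable_realfun.
From mathcomp Require Import ring lra zify.
Import Order.TTheory GRing.Theory Num.Theory.
Local Open Scope classical_set_scope.
Local Open Scope ring_scope.
Set Implicit Arguments. Unset Strict Implicit. Unset Printing Implicit Defensive.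

(* Give the vertices i.i.d. fair bits, one for each stage n, and start with all
   xi-open vertices active.  At stage n look at the clusters of the active
   vertices whose n-th bit is 1.  A finite cluster K in which fewer than
   alpha |K| vertices have an active neighbour with bit 0 is retired: it ceases
   to be active, and those exposed vertices are deleted, which disconnects the
   rest of K from the graph.

   Rate: a vertex retires at most once, and a retiring cluster K deletes fewer
   than alpha |K| vertices.  Letting each deleted vertex charge every vertex of
   its cluster, the mass transport principle, applied separately for each stage,
   each |K| and each number of deleted vertices, bounds the rate by alpha.

   Expansion: a surviving vertex of a retired cluster lies in a finite component,
   so an infinite component stays active for ever.  If it contained a connected
   K violating the expansion bound, then at all late stages the active
   neighbours of K would be those of the limit, and almost surely at one of
   these stages the bits would be 1 on K and 0 on its neighbours, so that K
   would have retired.  A disconnected K splits into connected pieces whose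
   inner boundaries are disjoint. *)

(** * Binary digits *)

Section dyadic_digits.
Variable R : realType.
Implicit Types (x : R) (c : nat -> bool) (N : nat).

(** For [x] in $[0,1)$ this is the truncation of [x] to [N] binary digits. The greedy recursion
    gives its measurability by induction on [N]. *)
Fixpoint dyadic_floor x N : R :=
  if N is m.+1 then
    if dyadic_floor x m + 2 ^- m.+1 <= x then dyadic_floor x m + 2 ^- m.+1
    else dyadic_floor x m
  else 0.

Definition dyadic_digit x N : bool := dyadic_floor x N + 2 ^- N.+1 <= x.

Fixpoint dyadic_point c N : R :=
  if N is m.+1 then dyadic_point c m + (if c m then 2 ^- m.+1 else 0) else 0.

Lemma exp2VS N : 2 ^- N = 2 ^- N.+1 + 2 ^- N.+1 :> R.
Proof.
have : (2 : R) ^+ N != 0 by rewrite expf_neq0.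
by rewrite exprS => h; field.
Qed.

Lemma exp2V_gt0 N : 0 < 2 ^- N :> R.
Proof. by rewrite invr_gt0 exprn_gt0. Qed.

Lemma dyadic_floor_digits x c N :
  (forall i, (i < N)%N -> dyadic_digit x i = c i) ->
  dyadic_floor x N = dyadic_point c N.
Proof.
elim: N => //= N IH h.
have h1 : dyadic_floor x N = dyadic_point c N by apply: IH => i iN; apply: h; lia.
rewrite -(h N (ltnSn N)) /dyadic_digit h1.
by case: ifP => _; rewrite ?addr0.
Qed.

(** Each further digit tells in which half of the current dyadic interval [x] lies. *)
Lemma dyadic_digits_itv x c N : 0 <= x < 1 ->
  (forall i, (i < N)%N -> dyadic_digit x i = c i) <->
  dyadic_point c N <= x < dyadic_point c N + 2 ^- N.
Proof.
move=> x01; elim: N => [|N IH].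
  by rewrite /= add0r expr0 invr1; split.
have sp := exp2VS N; have p0 := exp2V_gt0 N.+1.
split=> [h|].
  have h1 i : (i < N)%N -> dyadic_digit x i = c i by move=> iN; apply: h; lia.
  move/IH : (h1) => /andP[h2 h3].
  have := h N (ltnSn N); rewrite /dyadic_digit (dyadic_floor_digits h1) /= => <-.
  by case: ifP => h4; apply/andP; split; lra.
move=> /= /andP[h1 h2].
have h3 : forall i, (i < N)%N -> dyadic_digit x i = c i.
  by apply/IH; move: h1 h2; case: ifP => _ h1 h2; apply/andP; split; lra.
move=> i; rewrite ltnS leq_eqVlt => /orP[/eqP->|]; last exact: h3.
rewrite /dyadic_digit (dyadic_floor_digits h3).
by move: h1 h2; case: (c N) => h1 h2; [apply/idP|apply/negbTE]; lra.
Qed.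

Lemma measurable_dyadic_floor N :
  measurable_fun [set: measurableTypeR R] (fun x => dyadic_floor x N).
Proof.
elim: N => [|N IH] /=; first exact: measurable_cst.
apply: measurable_fun_ifT => //.
- by apply: measurable_fun_ler => //; apply: measurable_funD.
- by apply: measurable_funD.
Qed.

Lemma measurable_dyadic_digit N :
  measurable_fun [set: measurableTypeR R] (dyadic_digit ^~ N).
Proof.
apply: measurable_fun_ler => //; apply: measurable_funD => //.
exact: measurable_dyadic_floor.
Qed.

Definition unit_digits (s : seq nat) c : set (measurableTypeR R) :=
  [set x | 0 <= x < 1 /\ (forall i, i \in s -> dyadic_digit x i = c i)].

Lemma measurable_unit_digits s c : measurable (unit_digits s c).
Proof.
have -> : unit_digits s c = `[0%R, 1%R[ `&`
    \bigcap_(i in [set i | i \in s]) ((dyadic_digit ^~ i) @^-1` [set c i]).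
  apply/seteqP; split=> x [] /=; rewrite in_itv.
    by move=> h1 h2; split.
  by move=> h1 h2; split.
apply: measurableI; first exact: measurable_itv.
apply: bigcap_measurableType => i _.
by rewrite -[X in measurable X]setTI; exact: measurable_dyadic_digit.
Qed.

(** For an initial segment of indices the set is a dyadic interval. Otherwise some index below a
    common bound is missing from [s]; splitting on that digit gives two disjoint sets, each
    prescribing one digit more, and the induction is on the number of missing indices. *)
Lemma lebesgue_unit_digits s c : uniq s ->
  lebesgue_measure (unit_digits s c) = (2 ^- size s)%:E.
Proof.
move: c; have full c N : lebesgue_measure (unit_digits (iota 0 N) c) = (2 ^- N)%:E.
  have p0 : forall m, 0 <= dyadic_point c m /\ dyadic_point c m + 2 ^- m <= 1.
    elim=> [|m [h1 h2]] /=; first by rewrite add0r expr0 invr1.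
    have sp := exp2VS m; have := exp2V_gt0 m.+1.
    by case: ifP => _ h; split; lra.
  have -> : unit_digits (iota 0 N) c =
      [set` `[dyadic_point c N, dyadic_point c N + 2 ^- N[].
    apply/seteqP; split=> x /=; rewrite in_itv /=.
      move=> [x01 h]; apply/(dyadic_digits_itv c N x01) => i iN.
      by apply: h; rewrite mem_iota add0n.
    move=> h; have x01 : 0 <= x < 1.
      by have [? ?] := p0 N; move/andP : h => [? ?]; apply/andP; split; lra.
    split=> // i; rewrite mem_iota add0n /=.
    by move: i; apply/(dyadic_digits_itv c N x01).
  rewrite lebesgue_measure_itv /= lte_fin ltrDl exp2V_gt0.
  by rewrite -EFinD addrAC subrr add0r.
(* This bound stays fixed while [s] grows to exhaust all indices below it. *)
move=> c us; pose N := (\max_(i <- s) i).+1.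
have sN : all (fun i => (i < N)%N) s.
  by apply/allP => i si; rewrite /N ltnS; exact: (@leq_bigmax_seq _ s xpredT id i).
clearbody N.
have sleN : (size s <= N)%N.
  rewrite -(size_iota 0 N); apply: uniq_leq_size => // i /(allP sN).
  by rewrite mem_iota.
move: us sN; move e : (N - size s)%N => k; elim: k s c e sleN => [|k IH] s c e sleN us sN.
  have eN : size s = N by lia.
  have -> : unit_digits s c = unit_digits (iota 0 N) c.
    (* A duplicate-free list of [N] indices below [N] is a permutation of [iota 0 N]. *)
    have ms : s =i iota 0 N.
      have /(uniq_min_size us) : {subset s <= iota 0 N}.
        by move=> i /(allP sN); rewrite mem_iota.
      by rewrite size_iota eN => /(_ (leqnn _))[].
    by apply/seteqP; split => x [h1 h2]; split=> // i; rewrite ?ms => hi; apply: h2; rewrite ?ms.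
  by rewrite full eN.
have [i iN nis] : exists2 i, (i < N)%N & i \notin s.
  apply: contrapT => h; have : (size (iota 0 N) <= size s)%N.
    apply: uniq_leq_size; first exact: iota_uniq.
    move=> i; rewrite mem_iota /= add0n => iN; apply/negPn/negP => nis.
    by apply: h; exists i.
  by rewrite size_iota; lia.
pose d b j := if j == i then b else c j.
have split2 : unit_digits s c =
    unit_digits (i :: s) (d true) `|` unit_digits (i :: s) (d false).
  apply/seteqP; split=> x.
    move=> [x01 h]; case e1 : (dyadic_digit x i); [left|right];
      split=> // j; rewrite inE /d; case: eqP => [->//|_ /=]; exact: h.
  have aux b : unit_digits (i :: s) (d b) x -> unit_digits s c x.
    move=> [x01 h]; split=> // j js.
    rewrite h ?inE ?js ?orbT// /d; case: eqP => // ji.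
    by move: js nis; rewrite ji => ->.
  by case; exact: aux.
have IHb b : lebesgue_measure (unit_digits (i :: s) (d b)) = (2 ^- (size s).+1)%:E.
  by apply: IH; rewrite /= ?nis ?iN ?subnS ?e // -subn_gt0 e.
transitivity (lebesgue_measure (unit_digits (i :: s) (d true)) +
              lebesgue_measure (unit_digits (i :: s) (d false)))%E; last first.
  by rewrite !IHb -EFinD -exp2VS.
rewrite split2; apply: measureU; [exact: measurable_unit_digits..|].
apply/seteqP; split=> // x [[_ h1] [_ h2]].
have := h1 i (mem_head _ _); rewrite (h2 i (mem_head _ _)) /d eqxx.
by [].
Qed.

End dyadic_digits.

(** * Countably many independent fair bits *)

Section fair_bits.
Variables (R : realType) (I : countType).
Implicit Types (s t u : seq I) (c : I -> bool) (l : seq (I * bool)).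

Definition bcyl s c : set (I -> bool) := [set b | forall i, i \in s -> b i = c i].

(** The empty set is included for stability under intersection: cylinders with conflicting
    prescriptions are disjoint. *)
Definition bcyls : set (set (I -> bool)) :=
  [set A | A = set0 \/ exists s c, uniq s /\ A = bcyl s c].

Definition bits := g_sigma_algebraType bcyls.

Lemma bcyl_undup s c : bcyl (undup s) c = bcyl s c.
Proof. by apply/seteqP; split=> b h i; have := h i; rewrite mem_undup. Qed.

Lemma bcyls_bcyl s c : bcyls (bcyl s c).
Proof. by right; exists (undup s), c; rewrite undup_uniq bcyl_undup. Qed.

Lemma measurable_bcyl s c : measurable (bcyl s c : set bits).
Proof. by apply: sub_sigma_algebra; exact: bcyls_bcyl. Qed.

Lemma measurable_bit i a : measurable ([set b | b i = a] : set bits).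
Proof.
have -> : [set b : bits | b i = a] = bcyl [:: i] (fun=> a).
  apply/seteqP; split=> b /= h; last by apply: h; rewrite inE.
  by move=> j; rewrite inE => /eqP->.
exact: measurable_bcyl.
Qed.

Lemma bcyls_setI : setI_closed bcyls.
Proof.
move=> A B [->|[s [c [_ ->]]]]; first by rewrite set0I; left.
move=> [->|[t [c' [_ ->]]]]; first by rewrite setI0; left.
have [h|h] := pselect (forall i, i \in s -> i \in t -> c i = c' i).
  have -> : bcyl s c `&` bcyl t c' =
      bcyl (s ++ t) (fun i => if i \in s then c i else c' i).
    apply/seteqP; split=> b.
      move=> [h1 h2] i; rewrite mem_cat; case: ifP => /= [/h1//|_ /h2//].
    move=> hb; split=> i hi; have := hb i; rewrite mem_cat hi ?orbT => -> //.
    by case: ifP => // si; rewrite h.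
  exact: bcyls_bcyl.
left; apply/seteqP; split=> // b [h1 h2]; apply: h => i si ti.
by rewrite -h1// h2.
Qed.

Definition unit_itv : set (measurableTypeR R) := [set x | 0 <= x < 1].

Lemma measurable_unit_itv : measurable unit_itv.
Proof.
have -> : unit_itv = [set` `[0%R, 1%R[] by apply/seteqP; split=> x; rewrite /= in_itv.
exact: measurable_itv.
Qed.

Definition unit_bits (x : measurableTypeR R) : bits :=
  fun i => dyadic_digit x (pickle i).

Lemma unit_bits_bcyl s c : exists c' : nat -> bool,
  unit_bits @^-1` (bcyl s c) `&` unit_itv = unit_digits (map pickle s) c'.
Proof.
(* Only codes of elements of [s] are constrained, so the default value is harmless. *)
exists (fun n => if unpickle n is Some i then c i else false).
apply/seteqP; split=> x; rewrite /bcyl /unit_bits /unit_digits /unit_itv /=.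
  by move=> [h x01]; split=> // _ /mapP[i si ->]; rewrite pickleK h.
move=> [x01 h]; split=> // i si.
by have := h _ (map_f pickle si); rewrite pickleK.
Qed.

Lemma measurable_unit_bits : measurable_fun unit_itv unit_bits.
Proof.
apply: (@measurability _ _ _ bits _ _ bcyls) => // _ [_ [->|[s [c [_ ->]]]] <-].
  by rewrite preimage_set0 setI0.
by rewrite setIC; have [c' ->] := unit_bits_bcyl s c; exact: measurable_unit_digits.
Qed.

(** The law of the binary digits of a uniform point of $[0,1)$, with digits indexed by [I] through
    [pickle]. *)
Definition fair (A : set bits) : \bar R :=
  lebesgue_measure (unit_itv `&` unit_bits @^-1` A).

Let fair0 : fair set0 = 0%E.
Proof. by rewrite /fair preimage_set0 setI0 measure0. Qed.

Let fair_ge0 A : (0 <= fair A)%E.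
Proof. exact: measure_ge0. Qed.

Let fair_sigma_additive : semi_sigma_additive fair.
Proof.
move=> F mF tF mUF; rewrite /fair preimage_bigcup setI_bigcupr.
have mG n : measurable (unit_itv `&` unit_bits @^-1` F n).
  by apply: measurable_unit_bits => //; exact: measurable_unit_itv.
apply: measure_semi_sigma_additive => //.
- apply/trivIsetP => i j _ _ ij; apply/seteqP; split=> // x [[_ h1] [_ h2]].
  have : (F i `&` F j) (unit_bits x) by split.
  by move/trivIsetP : tF => ->.
- exact: bigcup_measurable.
Qed.

HB.instance Definition _ := isMeasure.Build _ _ _ fair fair0 fair_ge0
  fair_sigma_additive.

Lemma fair_bcyl s c : uniq s -> fair (bcyl s c) = (2 ^- size s)%:E.
Proof.
move=> us; have [c' e] := unit_bits_bcyl s c.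
rewrite /fair setIC e lebesgue_unit_digits ?size_map//.
by rewrite map_inj_uniq//; exact: pcan_inj pickleK.
Qed.

Lemma bcyl_nil c : bcyl [::] c = setT.
Proof. by apply/seteqP; split. Qed.

Lemma fair_setT : fair setT = 1%E.
Proof. by rewrite -(bcyl_nil xpredT) fair_bcyl// expr0 invr1. Qed.

HB.instance Definition _ := Measure_isProbability.Build _ _ _ fair fair_setT.

Definition fair_prob : probability bits R := fair.

(* Bits outside [S] are dropped because an isomorphism of graphs on subsets of
   [nat] need not extend to an injection of [nat]. *)
Definition reindex_bits (S : pred I) (p : I -> I) (b : bits) : bits :=
  fun i => if S i then b (p i) else false.

(** A condition at an index outside [S] either holds always or never, as the bit there is false. A
    condition at [i] in [S] becomes one at [p i]; by injectivity these do not clash, and the [has]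
    expression recovers [c] at the preimage. *)
Lemma reindex_bits_bcyl S p s c : {in S &, injective p} -> uniq s ->
  reindex_bits S p @^-1` (bcyl s c) =
    if all (fun i => ~~ c i) [seq i <- s | ~~ S i] then
      bcyl (map p [seq i <- s | S i])
           (fun j => has (fun i => [&& S i, p i == j & c i]) s)
    else set0.
Proof.
move=> injp us; case: ifP => [/allP h|/negbT/allPn[i]].
  have key i : i \in s -> S i ->
      has (fun i' => [&& S i', p i' == p i & c i']) s = c i.
    move=> si Si; apply/hasP/idP => [[j sj /and3P[Sj /eqP pij cj]]|ci].
      by have <- : j = i by exact: injp.
    by exists i => //; rewrite Si eqxx.
  apply/seteqP; split=> b /= hb.
    move=> j /mapP[i]; rewrite mem_filter => /andP[Si si] ->.
    by rewrite key//; have := hb i si; rewrite /reindex_bits Si.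
  move=> i si; rewrite /reindex_bits; case: ifPn => Si.
    by rewrite hb ?key// map_f// mem_filter Si.
  by apply/esym/negbTE/h; rewrite mem_filter /= Si.
rewrite mem_filter /= negbK => /andP[Si si] ci.
apply/seteqP; split=> // b /(_ i si).
by rewrite /reindex_bits (negbTE Si) ci.
Qed.

Lemma measurable_reindex_bits S p : {in S &, injective p} ->
  measurable_fun setT (reindex_bits S p).
Proof.
move=> injp; apply: (@measurability _ _ _ bits _ _ bcyls) => // _ [_ [->|[s [c [us ->]]]] <-].
  by rewrite preimage_set0 setI0.
rewrite setTI reindex_bits_bcyl//; case: ifP => // _; exact: measurable_bcyl.
Qed.

(** The value does not depend on [p], so any two relabellings injective on [S] agree on cylinders
    and hence, cylinders being stable under intersection, on all measurable sets. *)
Lemma fair_reindex_bcyl S p s c : {in S &, injective p} -> uniq s ->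
  fair (reindex_bits S p @^-1` (bcyl s c)) =
    if all (fun i => ~~ c i) [seq i <- s | ~~ S i] then
      (2 ^- size [seq i <- s | S i])%:E
    else 0%E.
Proof.
move=> injp us; rewrite reindex_bits_bcyl//; case: ifP => _; last exact: measure0.
rewrite fair_bcyl ?size_map// map_inj_in_uniq ?filter_uniq//.
by move=> i j; rewrite !mem_filter => /andP[Si _] /andP[Sj _]; exact: injp.
Qed.

Local Notation pushforward_measure :=
  measure_function_pushforward__canonical__measure_function_Measure.

Lemma fair_reindex S p q (A : set bits) :
  {in S &, injective p} -> {in S &, injective q} -> measurable A ->
  fair (reindex_bits S p @^-1` A) = fair (reindex_bits S q @^-1` A).
Proof.
move=> injp injq mA.
pose mp := pushforward_measure fair (measurable_reindex_bits injp).
pose mq := pushforward_measure fair (measurable_reindex_bits injq).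
apply: (@measure_unique _ R bits bcyls (fun=> setT) _ _ _ _ mp mq) => //.
- exact: bcyls_setI.
- by move=> n; rewrite -(bcyl_nil xpredT); exact: bcyls_bcyl.
- exact: bigcup_const.
- move=> B [->|[s [c [us ->]]]]; first by rewrite !measure0.
  by rewrite /mp /mq /= /pushforward !fair_reindex_bcyl.
- by move=> n; rewrite /mp /= /pushforward preimage_setT fair_setT ltry.
Qed.

Lemma fair_integral_reindex S p q (f : bits -> \bar R) :
  {in S &, injective p} -> {in S &, injective q} ->
  measurable_fun setT f -> (forall b, (0 <= f b)%E) ->
  (\int[fair]_b f (reindex_bits S p b) = \int[fair]_b f (reindex_bits S q b))%E.
Proof.
move=> injp injq mf f0.
have push r : {in S &, injective r} ->
    (\int[fair]_b f (reindex_bits S r b) =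
     \int[pushforward fair (reindex_bits S r)]_b f b)%E.
  move=> injr; rewrite ge0_integral_pushforward ?preimage_setT//.
  exact: measurable_reindex_bits.
rewrite (push _ injp) (push _ injq).
apply: (eq_measure_integral (pushforward_measure fair (measurable_reindex_bits injq))
  (m1 := pushforward_measure fair (measurable_reindex_bits injp))) => A mA _.
exact: fair_reindex.
Qed.

(** Independence of disjoint blocks. The extra cylinder on [u] makes the induction on [m] close:
    avoiding block [m] within the cylinder on [u] is a difference of two instances for [m], one with
    [u] and one with [t m ++ u]. *)
Lemma fair_avoid_bcyls (t : nat -> seq I) k c m u :
  (forall n, uniq (t n) /\ size (t n) = k) ->
  (forall n n' i, i \in t n -> i \in t n' -> n = n') ->
  uniq u -> (forall n i, (n < m)%N -> i \in t n -> i \notin u) ->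
  fair ([set b | forall n, (n < m)%N -> ~ bcyl (t n) c b] `&` bcyl u c) =
  ((1 - 2 ^- k) ^+ m * 2 ^- size u)%:E.
Proof.
move=> ht dt; pose E m : set bits := [set b | forall n, (n < m)%N -> ~ bcyl (t n) c b].
have ES n : E n.+1 = E n `\` bcyl (t n) c.
  apply/seteqP; split=> b.
    by move=> h; split=> [j jn|]; apply: h => //; lia.
  by move=> [h1 h2] j; rewrite ltnS leq_eqVlt => /orP[/eqP->|/h1].
have mE n : measurable (E n).
  elim: n => [|n IH]; last by rewrite ES; apply: measurableD => //; exact: measurable_bcyl.
  by have -> : E 0%N = setT by apply/seteqP; split=> b // _ n.
rewrite -/(E m); elim: m u => [|m IH] u uu tu.
  have -> : E 0%N = setT by apply/seteqP; split=> b // _ n.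
  by rewrite setTI fair_bcyl// expr0 mul1r.
have cat_bcyl : bcyl u c `&` bcyl (t m) c = bcyl (t m ++ u) c.
  apply/seteqP; split=> b.
    by move=> [h1 h2] i; rewrite mem_cat => /orP[/h2|/h1].
  by move=> h; split=> i hi; apply: h; rewrite mem_cat hi ?orbT.
have -> : E m.+1 `&` bcyl u c = (E m `&` bcyl u c) `\` (E m `&` bcyl (t m ++ u) c).
  rewrite ES -cat_bcyl; apply/seteqP; split=> b.
    by move=> [[h1 h2] h3]; split => // -[_ [_ h4]].
  by move=> [[h1 h2] h3]; split => //; split=> // h4; apply: h3.
have [tm1 tm2] := ht m.
have uc : uniq (t m ++ u).
  rewrite cat_uniq tm1 uu andbT /=; apply/hasPn => i iu; apply/negP => it.
  by have := tu m i (ltnSn m) it; rewrite iu.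
rewrite measureD.
- transitivity (((1 - 2 ^- k) ^+ m * 2 ^- size u)%:E -
      ((1 - 2 ^- k) ^+ m * 2 ^- size (t m ++ u))%:E :> \bar R)%E.
    congr (_ - _)%E.
      by apply: IH => // n i nm; apply: tu; lia.
    have -> : (E m `&` bcyl u c) `&` (E m `&` bcyl (t m ++ u) c) =
        E m `&` bcyl (t m ++ u) c.
      by rewrite -cat_bcyl; apply/seteqP; split=> b; [case|move=> [h1 [h2 h3]]].
    apply: IH => // n i nm it; rewrite mem_cat negb_or (tu n)//; last by lia.
    by rewrite andbT; apply/negP => it'; move: nm; rewrite (dt _ _ _ it it') ltnn.
  rewrite -EFinB size_cat tm2 exprD invfM; congr (_%:E).
  by rewrite exprSr; ring.
- by apply: measurableI => //; exact: measurable_bcyl.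
- by apply: measurableI => //; exact: measurable_bcyl.
- by rewrite (le_lt_trans (probability_le1 fair_prob _)) ?ltry//;
    apply: measurableI => //; exact: measurable_bcyl.
Qed.

(** Missing the first [m] disjoint blocks of size [k] has probability $(1-2^{-k})^m$, which tends to
    0. *)
Lemma fair_recurrent (t : nat -> seq I) k c :
  (forall n, uniq (t n) /\ size (t n) = k) ->
  (forall n n' i, i \in t n -> i \in t n' -> n = n') ->
  fair_prob.-negligible [set b | forall n, ~ bcyl (t n) c b].
Proof.
move=> ht dt; pose E m : set bits := [set b | forall n, (n < m)%N -> ~ bcyl (t n) c b].
have mall : measurable ([set b | forall n, ~ bcyl (t n) c b] : set bits).
  have -> : [set b | forall n, ~ bcyl (t n) c b] =
      \bigcap_(n in setT) (~` (bcyl (t n) c : set bits)).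
    by apply/seteqP; split=> b h n; [move=> _|]; exact: h.
  by apply: bigcap_measurableType => n _; apply: measurableC; exact: measurable_bcyl.
apply/negligibleP => //; apply/eqP; rewrite -measure_le0.
pose q : R := 1 - 2 ^- k.
have q1 : `|q| < 1.
  have h1 : 0 < 2 ^- k :> R by rewrite invr_gt0 exprn_gt0.
  have h2 : 2 ^- k <= 1 :> R by rewrite invf_le1 ?exprn_gt0// exprn_ege1 ?ler1n.
  by rewrite ger0_norm /q; lra.
have le m : (fair_prob [set b | forall n, ~ bcyl (t n) c b] <= (q ^+ m)%:E)%E.
  have mE : measurable (E m).
    have -> : E m = \bigcap_(n in [set n | (n < m)%N]) (~` (bcyl (t n) c : set bits)).
      by apply/seteqP; split=> b h n; exact: h.
    by apply: bigcap_measurableType => n _; apply: measurableC; exact: measurable_bcyl.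
  have := @fair_avoid_bcyls t k c m [::] ht dt erefl (fun _ _ _ _ => erefl).
  rewrite bcyl_nil setIT expr0 invr1 mulr1 => <-.
  by apply: le_measure; rewrite ?inE//= => b h n _; exact: h.
have lim0 : (fun m => (q ^+ m)%:E) @ \oo --> (0 : \bar R)%E.
  by apply: cvg_EFin; [exact: nearW|exact: cvg_expr].
rewrite -(cvg_lim _ lim0)//; apply: lime_ge; first exact: cvgP lim0.
by apply: nearW => m; exact: le.
Qed.

End fair_bits.

(** * The deletion process on a fixed graph *)

Section reachability.

Lemma reach_refl (e : rel nat) u : reach e u u.
Proof. by exists [::]. Qed.

Lemma reach_trans (e : rel nat) u v w : reach e u v -> reach e v w -> reach e u w.
Proof.
move=> [p [pp <-]] [q [qq <-]]; exists (p ++ q).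
by rewrite cat_path pp qq last_cat.
Qed.

Lemma reach1 (e : rel nat) u v : e u v -> reach e u v.
Proof. by move=> uv; exists [:: v]; rewrite /= uv. Qed.

Lemma reach_ind (e : rel nat) (Q : nat -> Prop) u :
  Q u -> (forall v w, reach e u v -> Q v -> e v w -> Q w) ->
  forall v, reach e u v -> Q v.
Proof.
move=> Qu Qstep v [p [pp <-]].
elim/last_ind: p pp => [//|p w IH]; rewrite rcons_path last_rcons => /andP[pp ew].
by apply: Qstep ew; [exists p|exact: IH].
Qed.

Lemma reach_sym (e : rel nat) u v : symmetric e -> reach e u v -> reach e v u.
Proof.
move=> syme; apply: (@reach_ind e (fun v => reach e v u)); first exact: reach_refl.
by move=> {}v w _ vu vw; apply: reach_trans vu; apply: reach1; rewrite syme.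
Qed.

Lemma sub_reach (e e' : rel nat) u v : subrel e e' -> reach e u v -> reach e' u v.
Proof. by move=> ee' [p [pp pv]]; exists p; split => //; exact: sub_path pp. Qed.

End reachability.

Section deletion.
Variables (R : realType) (a : R).
Variables (V : pred nat) (E : rel nat) (Y : nat -> pred nat).
Implicit Types (A B : pred nat) (K L : seq nat).

(** Throughout, [A] stands for the currently active vertices and [B] for those whose current bit is
    1; [V] and [E] will be the open vertices and open edges. *)
Definition cluster_edge A B : rel nat :=
  fun u w => [&& E u w, A u, A w, B u & B w].

Definition exposed A B (u : nat) : Prop := exists w, [&& A w, E u w & ~~ B w].

(** Finiteness of the cluster is expressed by listing it as [K], with its exposed vertices listed as
    [L]. Quantifying over lists is countable, which later gives measurability. *)
Definition thin_cluster A B v K L : Prop :=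
  [/\ A v && B v, (forall w, w \in K <-> reach (cluster_edge A B) v w),
      uniq K && uniq L, (forall u, u \in L <-> u \in K /\ exposed A B u) &
      (size L)%:R < a * (size K)%:R].

Definition retired A B v : Prop := exists K L, thin_cluster A B v K L.

Fixpoint active n : pred nat :=
  if n is m.+1 then
    fun v => active m v && ~~ `[< retired (active m) (Y m) v >]
  else V.

Definition deleted v : Prop :=
  exists n, retired (active n) (Y n) v /\ exposed (active n) (Y n) v.

Hypothesis Esym : symmetric E.

Lemma cluster_edge_sym A B : symmetric (cluster_edge A B).
Proof.
move=> u w; rewrite /cluster_edge Esym.
by case: (E _ _); case: (A u); case: (A w); case: (B u); case: (B w).
Qed.

(** Since [E] is symmetric, clusters are equivalence classes, so all members share the same lists
    and retire together. *)
Lemma thin_cluster_member A B v K L u : thin_cluster A B v K L -> u \in K ->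
  thin_cluster A B u K L.
Proof.
move=> [ABv hK uKL hL sz] uK; have ru := (hK u).1 uK; split=> //.
- move: ru; apply: (@reach_ind _ (fun u => A u && B u)) => // x y _ _.
  by case/and5P => _ _ -> _ ->.
- move=> w; rewrite hK; split; apply: reach_trans => //.
  by apply: reach_sym ru; exact: cluster_edge_sym.
Qed.

Lemma thin_cluster_uniq A B v K L K' L' :
  thin_cluster A B v K L -> thin_cluster A B v K' L' -> K =i K' /\ L =i L'.
Proof.
move=> [_ hK _ hL _] [_ hK' _ hL' _].
have eK : K =i K' by move=> w; apply/idP/idP; [move/hK/hK'|move/hK'/hK].
split=> // u; apply/idP/idP.
  by move/hL => [uK eu]; apply/hL'; rewrite -eK.
by move/hL' => [uK eu]; apply/hL; rewrite eK.
Qed.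

Lemma active_leq m n v : (m <= n)%N -> active n v -> active m v.
Proof.
move=> /subnK <-; elim: (n - m)%N => [|k IH]; first by rewrite add0n.
by rewrite addSn /= => /andP[/IH].
Qed.

Lemma retired_active n v : retired (active n) (Y n) v -> active n v.
Proof. by move=> [K [L [/andP[]]]]. Qed.

Lemma retired_inactive m n v :
  retired (active n) (Y n) v -> (n < m)%N -> active m v = false.
Proof.
move=> rv nm; apply/negbTE/negP => /(active_leq nm) /= /andP[_ /negP]; apply.
exact/asboolP.
Qed.

Lemma retired_once m n v :
  retired (active n) (Y n) v -> retired (active m) (Y m) v -> n = m.
Proof.
move=> rn rm; have [lt|lt|//] := ltngtP n m.
  by have := retired_inactive rn lt; rewrite (retired_active rm).
by have := retired_inactive rm lt; rewrite (retired_active rn).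
Qed.

Lemma inactive_retired n v : V v -> active n v = false ->
  exists2 m, (m < n)%N & retired (active m) (Y m) v.
Proof.
move=> Vv; elim: n => [|n IH] /=; first by rewrite Vv.
move=> /negbT; rewrite negb_and negbK => /orP[/negbTE/IH[m mn rm]|/asboolP rn].
  by exists m => //; lia.
by exists n.
Qed.

Definition kept v := V v && ~~ `[< deleted v >].
Definition kept_edge : rel nat := fun u w => [&& kept u, kept w & E u w].

Lemma kept_edge_sym : symmetric kept_edge.
Proof. by move=> u w; rewrite /kept_edge Esym; case: (kept u); case: (kept w). Qed.

(** Suppose a kept edge left the cluster of [v] retiring at stage [n]. If [w] is still active, its
    bit is 0, so [v] is exposed and deleted. If [w] retired at an earlier stage, then [v] was active
    at that stage: with bit 1 it would have retired along with [w], and with bit 0 it exposes [w],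
    which is then deleted. *)
Lemma kept_retired_closed n v w K L :
  thin_cluster (active n) (Y n) v K L -> kept_edge v w -> w \in K.
Proof.
move=> tv /and3P[/andP[Vv /negP dv] /andP[Vw /negP dw] Evw].
have rv : retired (active n) (Y n) v by exists K, L.
have Av := retired_active rv.
have [ABv hK _ _ _] := tv.
case Aw : (active n w).
  case Yw : (Y n w).
    apply/hK; apply: reach1; rewrite /cluster_edge Evw Av Aw Yw.
    by case/andP : ABv => _ ->.
  case: dv; apply/asboolP; exists n; split => //.
  by exists w; rewrite Aw Evw Yw.
have [m mn rw] := inactive_retired Vw Aw.
case: dw; apply/asboolP; exists m; split => //.
have Avm := active_leq (ltnW mn) Av.
exists v; rewrite Avm Esym Evw /=; apply/negP => Yv.
have [K' [L' tw]] := rw.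
have vK' : v \in K'.
  case: tw => /andP[Aw' Yw'] hK' _ _ _; apply/hK'; apply: reach1.
  by rewrite /cluster_edge Esym Evw Aw' Avm Yw' Yv.
have rv' : retired (active m) (Y m) v by exists K', L'; exact: thin_cluster_member tw vK'.
by have := retired_inactive rv' mn; rewrite Av.
Qed.

Definition kept_comp v : set nat := [set w | kept v /\ reach kept_edge v w].

Lemma kept_comp_kept v w : kept_comp v w -> kept w.
Proof.
move=> [kv]; apply: (@reach_ind _ kept) => // x y _ _ /and3P[_ ky _].
exact: ky.
Qed.

Lemma kept_comp_step v u w : kept_comp v u -> kept_edge u w -> kept_comp v w.
Proof. by move=> [kv vu] uw; split=> //; apply: reach_trans vu (reach1 uw). Qed.

(** By [kept_retired_closed], the component of a kept vertex that retires stays inside its finite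
    cluster. *)
Lemma infinite_kept_comp_active v n : kept v -> ~ finite_set (kept_comp v) ->
  active n v.
Proof.
move=> kv; apply: contra_notT => /negbTE nA.
have Vv : V v by case/andP : kv.
have [m _ [K [L tv]]] := inactive_retired Vv nA.
apply: (@sub_finite_set _ _ [set` K]); last exact: finite_seq.
move=> w [_] /=; apply: (@reach_ind _ (fun w => w \in K)).
  by case: tv => _ hK _ _ _; apply/hK; exact: reach_refl.
move=> x y _ xK xy; exact: kept_retired_closed (thin_cluster_member tv xK) xy.
Qed.

Lemma infinite_kept_comp_member_active v w n :
  ~ finite_set (kept_comp v) -> kept_comp v w -> active n w.
Proof.
move=> infv vw; apply: infinite_kept_comp_active; first exact: kept_comp_kept vw.
apply: contra_not infv; apply: sub_finite_set => x [kv vx].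
split; first exact: kept_comp_kept vw.
apply: reach_trans vx; apply: reach_sym; first exact: kept_edge_sym.
by case: vw.
Qed.

Hypothesis Efin : forall u, exists n, forall v, E u v -> (v < n)%N.
(** The deterministic trace of randomness on which expansion rests: every finite bit pattern recurs
    at arbitrarily late stages. Fair bits satisfy it almost surely. *)
Hypothesis Yrec : forall (s t : seq nat) N,
  exists2 n, (N <= n)%N & forall v, v \in t -> Y n v = (v \in s).

Definition comp_exposed v K u : bool :=
  `[< exists w, kept_comp v w /\ w \notin K /\ kept_edge u w >].

Lemma neighbours_bound K : exists M, forall u w, u \in K -> E u w -> (w < M)%N.
Proof.
elim: K => [|u K [M IH]]; first by exists 0%N.
have [n hn] := Efin u; exists (maxn n M) => x w; rewrite inE => /orP[/eqP->|xK] xw.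
  by have := hn w xw; lia.
by have := IH x w xK xw; lia.
Qed.

(** Activity is decreasing in the stage, so each of the finitely many vertices below [M] either
    stays active or is lost at a definite stage. *)
Lemma active_stabilizes M : exists N, forall n w, (w < M)%N -> (N <= n)%N ->
  active n w -> forall m, active m w.
Proof.
elim: M => [|M [N IH]]; first by exists 0%N.
have [h|h] := pselect (forall m, active m M).
  by exists N => n w; rewrite ltnS leq_eqVlt => /orP[/eqP->|wM] // Nn; exact: IH Nn.
have [m hm] : exists m, ~ active m M by apply: contrapT => h'; apply: h => m;
  apply: contrapT => hm; apply: h'; exists m.
exists (maxn N m) => n w; rewrite ltnS leq_eqVlt => /orP[/eqP->|wM] Nn An.
  by case: hm; apply: active_leq An; lia.
by apply: IH An => //; lia.
Qed.

Lemma connected_expansion v K : ~ finite_set (kept_comp v) ->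
  uniq K -> K != [::] -> (forall u, u \in K -> kept_comp v u) ->
  (forall u w, u \in K -> w \in K ->
     reach (fun x y => [&& x \in K, y \in K & kept_edge x y]) u w) ->
  a * (size K)%:R <= (count (comp_exposed v K) K)%:R.
Proof.
move=> infv uK; case eK : K => [//|v0 K0] _; rewrite -eK => KC conK.
have v0K : v0 \in K by rewrite eK mem_head.
rewrite leNgt; apply/negP => thin.
have [M hM] := neighbours_bound K.
have [N hN] := active_stabilizes M.
(* At this late stage the bits are 1 on [K] and 0 at every other vertex below [M], in particular at
   all outside neighbours of [K]. The list contains [K] explicitly because [K] itself need not lie
   below [M]. *)
have [n Nn hY] := Yrec K (K ++ iota 0 M) N.
have YK u : u \in K -> Y n u by move=> uK'; rewrite hY// mem_cat uK'.
have YM w : (w < M)%N -> Y n w = (w \in K).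
  by move=> wM; rewrite hY// mem_cat mem_iota /= add0n wM orbT.
have AK u m : u \in K -> active m u.
  by move=> uK'; apply: (infinite_kept_comp_member_active _ infv (KC _ uK')).
suff rv0 : retired (active n) (Y n) v0.
  by have := retired_inactive rv0 (ltnSn n); rewrite AK.
(* The cluster of [v0] is exactly [K], and its exposed vertices are its inner boundary in the
   component, so the assumed failure of expansion makes it retire. *)
exists K, [seq u <- K | comp_exposed v K u]; split.
- by rewrite AK// YK.
- move=> w; split=> [wK|].
    apply: sub_reach (conK _ _ v0K wK) => x y /and3P[xK yK /and3P[_ _ xy]].
    by rewrite /cluster_edge xy !AK// !YK.
  apply: (@reach_ind _ (fun w => w \in K)) => // x y _ xK /and5P[xy _ _ _ Yy].
  by rewrite -YM//; exact: hM xK xy.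
- by rewrite uK filter_uniq.
- move=> u; rewrite mem_filter; split.
    move=> /andP[/asboolP[w [Cw [wK /and3P[_ _ uw]]]] uK']; split=> //.
    exists w; rewrite uw (infinite_kept_comp_member_active _ infv Cw) /=.
    by rewrite YM//; exact: hM uw.
  move=> [uK' [w /and3P[Aw uw Yw]]]; rewrite uK' andbT; apply/asboolP.
  have wM := hM _ _ uK' uw; exists w.
  have Aall := hN n w wM Nn Aw.
  (* Deletion happens only on retiring, so a vertex that is active for ever is kept. *)
  have kw : kept w.
    apply/andP; split; first exact: (Aall 0%N).
    by apply/negP => /asboolP[m [rm _]]; have := retired_inactive rm (ltnSn m); rewrite Aall.
  have kuw : kept_edge u w by rewrite /kept_edge (kept_comp_kept (KC _ uK')) kw.
  split; first exact: kept_comp_step (KC _ uK') kuw.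
  by split => //; rewrite -YM.
- by rewrite size_filter.
Qed.

(** Induction on the size: if [K] is not connected, cut it into the part [Q] reachable from [v0]
    inside [K] and the rest. Both parts are smaller and both sides of the inequality add up. *)
Lemma expansion v K : ~ finite_set (kept_comp v) ->
  uniq K -> (forall u, u \in K -> kept_comp v u) ->
  a * (size K)%:R <= (count (comp_exposed v K) K)%:R.
Proof.
move=> infv; move: {2}(size K) (leqnn (size K)) => n.
elim: n K => [|n IH] K szK uK KC.
  by move: szK; rewrite leqn0 size_eq0 => /eqP->; rewrite /= mulr0.
case eK : K => [|v0 K0]; first by rewrite /= mulr0.
rewrite -eK; have v0K : v0 \in K by rewrite eK mem_head.
pose e x y := [&& x \in K, y \in K & kept_edge x y].
have esym : symmetric e.
  move=> x y; rewrite /e kept_edge_sym.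
  by case: (x \in K); case: (y \in K).
pose Q u := `[< reach e v0 u >].
have Qv0 : Q v0 by apply/asboolP; exact: reach_refl.
have Qe x y : e x y -> Q x = Q y.
  move=> xy; apply/asboolP/asboolP => h; apply: reach_trans h _; apply: reach1 => //.
  by rewrite esym.
have [allQ|] := boolP (all Q K).
  apply: connected_expansion => //; first by rewrite eK.
  move=> u w uK' wK; apply: (@reach_trans _ _ v0).
    apply: reach_sym; first exact: esym.
    by apply/asboolP; move/allP : allQ; apply.
  by apply/asboolP; move/allP : allQ; apply.
move=> /allPn[w0 w0K nQ].
have part (S : pred nat) : (exists2 x, x \in K & ~~ S x) ->
    (forall x y, e x y -> S x = S y) ->
    a * (count S K)%:R <= (count (predI S (comp_exposed v K)) K)%:R.
  move=> [x0 x0K nS] Se; rewrite -size_filter.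
  have szS : (size [seq x <- K | S x] <= n)%N.
    rewrite -ltnS; apply: leq_trans szK; rewrite size_filter -(count_predC S K).
    rewrite -[X in (X < _)%N]addn0 ltn_add2l.
    by rewrite -has_count; apply/hasP; exists x0.
  have SC u : u \in [seq x <- K | S x] -> kept_comp v u by rewrite mem_filter => /andP[_ /KC].
  apply: le_trans (IH _ szS (filter_uniq _ uK) SC) _.
  rewrite ler_nat count_filter -!size_filter; apply: uniq_leq_size; first exact: filter_uniq.
  (* No edge inside [K] crosses between [S] and its complement, so a neighbour outside the part [S]
     is outside [K] altogether. *)
  move=> u; rewrite !mem_filter /= => /andP[/andP[/asboolP[w [Cw [wS uw]]] Su] uK'].
  rewrite Su uK' andbT /=; apply/asboolP; exists w; split=> //; split=> //.
  apply: contra wS => wK; rewrite mem_filter wK andbT -(Se u w)//.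
  by rewrite /e uK' wK.
have e1 : (size K = count Q K + count (predC Q) K)%N by rewrite count_predC.
have e2 : (count (comp_exposed v K) K =
    count (predI Q (comp_exposed v K)) K + count (predI (predC Q) (comp_exposed v K)) K)%N.
  have := count_predC Q [seq u <- K | comp_exposed v K u]; rewrite !count_filter size_filter => <-.
  by [].
rewrite e1 e2 !natrD mulrDr; apply: lerD.
  by apply: part => //; exists w0.
by apply: part => [|x y /Qe /= ->//]; exists v0 => //=; rewrite negbK.
Qed.

End deletion.

(** * Measurability, charges and relabelling invariance *)

Section measurable_predicates.
Context d (T : measurableType d).

Lemma measurable_exists (I : countType) (Q : I -> T -> Prop) :
  (forall i, measurable [set t | Q i t]) -> measurable [set t | exists i, Q i t].
Proof.
move=> mQ.
have -> : [set t | exists i, Q i t] =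
    \bigcup_n (if unpickle n is Some i then [set t | Q i t] else set0).
  apply/seteqP; split=> t.
    by move=> [i Qi]; exists (pickle i) => //; rewrite pickleK.
  by move=> [n _]; case: unpickle => // i Qi; exists i.
by apply: bigcupT_measurable => n; case: unpickle.
Qed.

Lemma measurable_not (Q : T -> Prop) :
  measurable [set t | Q t] -> measurable [set t | ~ Q t].
Proof. exact: measurableC. Qed.

Lemma measurable_and (Q Q' : T -> Prop) : measurable [set t | Q t] ->
  measurable [set t | Q' t] -> measurable [set t | Q t /\ Q' t].
Proof. exact: measurableI. Qed.

Lemma measurable_andb (p q : T -> bool) : measurable [set t | p t] ->
  measurable [set t | q t] -> measurable [set t | p t && q t].
Proof.
move=> mp mq; have -> : [set t | p t && q t] = [set t | p t /\ q t].
  by apply/seteqP; split=> t /= => [/andP|] [-> ->].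
exact: measurable_and.
Qed.

Lemma measurable_negb (p : T -> bool) : measurable [set t | p t] ->
  measurable [set t | ~~ p t].
Proof.
move=> mp; have -> : [set t | ~~ p t] = [set t | ~ p t].
  by apply/seteqP; split=> t /= => /negP.
exact: measurable_not.
Qed.

Lemma measurable_asbool (Q : T -> Prop) : measurable [set t | Q t] ->
  measurable [set t | `[< Q t >]].
Proof.
move=> mQ; have -> // : [set t | `[< Q t >]] = [set t | Q t].
by apply/seteqP; split=> t /= => /asboolP.
Qed.

Lemma measurable_forall (I : countType) (Q : I -> T -> Prop) :
  (forall i, measurable [set t | Q i t]) -> measurable [set t | forall i, Q i t].
Proof.
move=> mQ; have -> : [set t | forall i, Q i t] = [set t | ~ exists i, ~ Q i t].
  apply/seteqP; split=> t /= h; first by move=> [i]; apply.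
  by move=> i; apply: contrapT => nQ; apply: h; exists i.
by apply: measurable_not; apply: measurable_exists => i; exact: measurable_not.
Qed.

Lemma measurable_iff_cst (c : Prop) (Q : T -> Prop) : measurable [set t | Q t] ->
  measurable [set t | c <-> Q t].
Proof.
move=> mQ; have [hc|hc] := pselect c.
  have -> // : [set t | c <-> Q t] = [set t | Q t].
  by apply/seteqP; split=> t /=; tauto.
have -> : [set t | c <-> Q t] = [set t | ~ Q t].
  by apply/seteqP; split=> t /=; tauto.
exact: measurable_not.
Qed.

Lemma measurable_cst_prop (c : Prop) : measurable [set t : T | c].
Proof.
have [hc|hc] := pselect c.
  by have -> : [set t : T | c] = setT by apply/seteqP; split.
by have -> : [set t : T | c] = set0 by apply/seteqP; split.
Qed.

Lemma measurable_reach (e : T -> rel nat) u v :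
  (forall x y, measurable [set t | e t x y]) -> measurable [set t | reach (e t) u v].
Proof.
move=> me; apply: measurable_exists => p; apply: measurable_and; last exact: measurable_cst_prop.
elim: p u => [u|w p IH u] /=; first exact: measurable_cst_prop.
exact: measurable_andb.
Qed.

Variables (R : realType) (a : R).
Variables (V : T -> pred nat) (E : T -> rel nat) (Y : T -> nat -> pred nat).
Hypothesis mV : forall v, measurable [set t | V t v].
Hypothesis mE : forall u v, measurable [set t | E t u v].
Hypothesis mY : forall n v, measurable [set t | Y t n v].

Lemma measurable_exposed (A B : T -> pred nat) u :
  (forall v, measurable [set t | A t v]) -> (forall v, measurable [set t | B t v]) ->
  measurable [set t | exposed (E t) (A t) (B t) u].
Proof.
move=> mA mB; apply: measurable_exists => w.
by do 2 apply: measurable_andb => //; exact: measurable_negb.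
Qed.

Lemma measurable_thin_cluster (A B : T -> pred nat) v K L :
  (forall v, measurable [set t | A t v]) -> (forall v, measurable [set t | B t v]) ->
  measurable [set t | thin_cluster a (E t) (A t) (B t) v K L].
Proof.
move=> mA mB.
have -> : [set t | thin_cluster a (E t) (A t) (B t) v K L] =
    [set t | (A t v && B t v) /\
      (forall w, w \in K <-> reach (cluster_edge (E t) (A t) (B t)) v w) /\
      uniq K && uniq L /\
      (forall u, u \in L <-> u \in K /\ exposed (E t) (A t) (B t) u) /\
      (size L)%:R < a * (size K)%:R].
  by apply/seteqP; split=> t /= => [[]|[? [? [? []]]]].
apply: measurable_and; first exact: measurable_andb.
apply: measurable_and.
  apply: measurable_forall => w; apply: measurable_iff_cst; apply: measurable_reach => x y.
  by do 4 apply: measurable_andb => //.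
apply: measurable_and; first exact: measurable_cst_prop.
apply: measurable_and; last exact: measurable_cst_prop.
apply: measurable_forall => w; apply: measurable_iff_cst; apply: measurable_and.
  exact: measurable_cst_prop.
exact: measurable_exposed.
Qed.

Lemma measurable_retired (A B : T -> pred nat) v :
  (forall v, measurable [set t | A t v]) -> (forall v, measurable [set t | B t v]) ->
  measurable [set t | retired a (E t) (A t) (B t) v].
Proof.
move=> mA mB; apply: measurable_exists => K; apply: measurable_exists => L.
exact: measurable_thin_cluster.
Qed.

Lemma measurable_active n v : measurable [set t | active a (V t) (E t) (Y t) n v].
Proof.
elim: n v => [|n IH] v //=; apply: measurable_andb => //.
by apply: measurable_negb; apply: measurable_asbool; exact: measurable_retired.
Qed.

Lemma measurable_deleted v : measurable [set t | deleted a (V t) (E t) (Y t) v].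
Proof.
apply: measurable_exists => n; apply: measurable_and.
  by apply: measurable_retired => // w; exact: measurable_active.
by apply: measurable_exposed => // w; exact: measurable_active.
Qed.

End measurable_predicates.

(** * Mass sent and received within a fixed graph *)

Section charges.
Variables (R : realType) (a : R).
Variables (V : pred nat) (E : rel nat) (Y : nat -> pred nat).
Local Notation act := (active a V E Y).

(* A code [c] is (stage, (size of the cluster, number of its exposed vertices)). *)
Definition retired_with (c : nat * (nat * nat)) x K L :=
  thin_cluster a E (act c.1) (Y c.1) x K L /\ size K = c.2.1 /\ size L = c.2.2.

Definition charged c x := exists K L, retired_with c x K L.

Definition charged_exposed c x := charged c x /\ exposed E (act c.1) (Y c.1) x.

Definition charges c x y := exists K L,
  retired_with c x K L /\ exposed E (act c.1) (Y c.1) x /\ y \in K.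

Lemma deleted_charged x : deleted a V E Y x <-> exists c, charged_exposed c x.
Proof.
split=> [[n [[K [L t]] e]]|[c [[K [L [t _]]] e]]].
  by exists (n, (size K, size L)); split=> //; exists K, L.
by exists c.1; split => //; exists K, L.
Qed.

Lemma charged_bad c x : charged c x -> c.2.2%:R < a * c.2.1%:R.
Proof. by move=> [K [L [[_ _ _ _ lt] [<- <-]]]]. Qed.

Lemma retired_with_carrier c x K L u : retired_with c x K L -> u \in K -> V u.
Proof.
move=> [[/andP[Ax Bx] hK _ _ _] _] uK; apply: (active_leq (leq0n c.1)).
move/hK : uK; apply: (@reach_ind _ (act c.1)) => // y z _ _.
by case/and5P.
Qed.

(** The mass sent by [x]: an exposed vertex of a retiring cluster charges the whole cluster, whose
    size is fixed by the code. *)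
Lemma charges_out c x : exists K : seq nat, [/\ uniq K, forall y, y \in K -> V y,
  forall y, charges c x y <-> y \in K &
  size K = if `[< charged_exposed c x >] then c.2.1 else 0%N].
Proof.
case: asboolP => [[[K [L rw]] e]|ne].
  exists K; split; [|by move=> y; exact: retired_with_carrier rw| |by case: rw => _ []].
    by case: rw => -[_ _ /andP[]].
  move=> y; split=> [[K' [L' [rw' [_ yK']]]]|yK]; last by exists K, L.
  by rewrite (thin_cluster_uniq rw.1 rw'.1).1.
exists [::]; split=> // y; split=> // -[K [L [rw [e yK]]]]; case: ne.
by split=> //; exists K, L.
Qed.

(** The mass received by [y]: each vertex of a retiring cluster is charged by exactly the exposed
    vertices of that cluster, and the code fixes their number. *)
Lemma charges_in c y : symmetric E -> exists L : seq nat, [/\ uniq L,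
  forall x, x \in L -> V x, forall x, charges c x y <-> x \in L &
  size L = if `[< charged c y >] then c.2.2 else 0%N].
Proof.
move=> Esym; case: asboolP => [[K [L rw]]|nc].
  have [[_ hK /andP[_ uL] hL _] [szK szL]] := rw.
  have yK : y \in K by apply/hK; exact: reach_refl.
  exists L; split=> //.
    by move=> x /hL[xK _]; exact: retired_with_carrier rw xK.
  move=> x; split=> [[K' [L' [[t' sz'] [ex yK']]]]|/hL[xK ex]].
    apply/hL; split => //.
    have [eK _] := thin_cluster_uniq (thin_cluster_member Esym t' yK') rw.1.
    rewrite -eK; case: t' => _ hK' _ _ _; apply/hK'; exact: reach_refl.
  by exists K, L; split=> //; split=> //; exact: thin_cluster_member rw.1 xK.
exists [::]; split=> // x; split=> // -[K [L [[t sz] [e yK]]]]; case: nc.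
by exists K, L; split=> //; exact: thin_cluster_member t yK.
Qed.

(** A vertex retires at one stage only, and there its lists are determined up to order. Hence the
    retirement events of different codes are disjoint. *)
Lemma charged_once c c' x : charged c x -> charged c' x -> c = c'.
Proof.
move=> [K [L [t [k l]]]] [K' [L' [t' [k' l']]]].
have e : c.1 = c'.1 by apply: retired_once; [exists K, L; exact: t|exists K', L'].
move: c c' t k l t' k' l' e => [n [k l]] [n' [k' l']] /= t ek el t' ek' el' e.
subst n'; have [eK eL] := thin_cluster_uniq t t'.
have [[_ _ /andP[uK uL] _ _] [_ _ /andP[uK' uL'] _ _]] := (t, t').
have sz (s s' : seq nat) : uniq s -> uniq s' -> s =i s' -> size s = size s'.
  by move=> us us' ss'; apply: perm_size; apply: uniq_perm.
by rewrite -ek -el -ek' -el' (sz K K')// (sz L L').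
Qed.

End charges.

(** * Invariance of the process under isomorphism *)

Section relabelling.
Variables (R : realType) (a : R).

Definition relabels (V1 : pred nat) (E1 : rel nat) (Y1 : nat -> pred nat)
    (V2 : pred nat) (E2 : rel nat) (Y2 : nat -> pred nat) (p : nat -> nat) :=
  [/\ (forall u, V1 u -> V2 (p u)), {in V1 &, injective p},
      (forall w, V2 w -> exists2 u, V1 u & p u = w),
      (forall u v, V1 u -> V1 v -> E2 (p u) (p v) = E1 u v) &
      (forall n u, V1 u -> Y2 n (p u) = Y1 n u)].

Lemma relabels_sym V1 E1 Y1 V2 E2 Y2 p : relabels V1 E1 Y1 V2 E2 Y2 p ->
  exists2 q, relabels V2 E2 Y2 V1 E1 Y1 q & forall u, V1 u -> q (p u) = u.
Proof.
move=> [pV pinj pon pE pY].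
(* Choose a preimage of each vertex of [V2]; the value 0 elsewhere is arbitrary. *)
have /choice[q hq] w : exists u, V2 w -> V1 u /\ p u = w.
  by have [/pon[u Vu pu]|nw] := boolP (V2 w); [exists u|exists 0%N].
have qp u : V1 u -> q (p u) = u.
  by move=> Vu; have [h1 h2] := hq _ (pV _ Vu); exact: pinj.
exists q => //; split.
- by move=> u /hq[].
- by move=> u v Vu Vv e; rewrite -(hq u Vu).2 -(hq v Vv).2 e.
- by move=> w Vw; exists (p w); [exact: pV|exact: qp].
- by move=> u v /hq[Vu {2}<-] /hq[Vv {2}<-]; rewrite pE.
- by move=> n u /hq[Vu {2}<-]; rewrite pY.
Qed.

(** Arbitrary [A] and [B] let this serve within the induction showing that activity is invariant.
    For thin clusters one direction suffices, as [relabels_sym] supplies the other. *)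
Lemma relabels_thin_cluster V1 E1 Y1 V2 E2 Y2 p (A1 B1 A2 B2 : pred nat) v K L :
  relabels V1 E1 Y1 V2 E2 Y2 p ->
  (forall u, A1 u -> V1 u) -> (forall u, A2 u -> V2 u) ->
  (forall u, V1 u -> A2 (p u) = A1 u) -> (forall u, V1 u -> B2 (p u) = B1 u) ->
  (forall u, V1 u -> exposed E1 A1 B1 u <-> exposed E2 A2 B2 (p u)) /\
  (thin_cluster a E1 A1 B1 v K L ->
   thin_cluster a E2 A2 B2 (p v) (map p K) (map p L)).
Proof.
move=> [pV pinj pon pE pY] AV1 AV2 pA pB.
have exp u : V1 u -> exposed E1 A1 B1 u <-> exposed E2 A2 B2 (p u).
  move=> Vu; split=> [[w /and3P[Aw uw Bw]]|[w /and3P[Aw uw Bw]]].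
    have Vw := AV1 _ Aw.
    by exists (p w); rewrite pA// Aw pE// uw pB// Bw.
  have [w' Vw' e] := pon _ (AV2 _ Aw); exists w'.
  by rewrite -pA// -pE// -pB// e Aw uw Bw.
split=> // -[/andP[Av Bv] hK /andP[uK uL] hL sz].
have Vv := AV1 _ Av.
have edge x y : V1 x -> V1 y ->
    cluster_edge E2 A2 B2 (p x) (p y) = cluster_edge E1 A1 B1 x y.
  by move=> Vx Vy; rewrite /cluster_edge pE// !pA// !pB.
have KV x : x \in K -> V1 x.
  by move/hK; apply: (@reach_ind _ V1) => // y z _ _ /and5P[_ _ /AV1].
have LV x : x \in L -> V1 x by move/hL => [/KV].
split.
- by rewrite pA// pB// Av.
- move=> w; split.
    move=> /mapP[u /hK uK' ->]; apply: (@reach_ind (cluster_edge E1 A1 B1)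
      (fun u => reach (cluster_edge E2 A2 B2) (p v) (p u))) uK'.
      exact: reach_refl.
    move=> x y _ h xy; apply: reach_trans h _; apply: reach1; rewrite edge//;
      by case/and5P : xy => _ /AV1 ? /AV1.
  apply: (@reach_ind _ (fun w => w \in map p K)).
    by apply: map_f; apply/hK; exact: reach_refl.
  move=> _ y _ /mapP[x xK ->] xy.
  have [y' Vy' e] : exists2 y', V1 y' & p y' = y.
    by apply: pon; apply: AV2; case/and5P : xy.
  rewrite -e; apply: map_f; apply/hK; apply: reach_trans ((hK x).1 xK) _.
  by apply: reach1; rewrite -edge ?e//; exact: KV.
- rewrite !map_inj_in_uniq ?uK ?uL// => x y hx hy; apply: pinj.
  + exact: LV.
  + exact: LV.
  + exact: KV.
  + exact: KV.
- move=> u; split.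
    move=> /mapP[x xL ->]; have [xK ex] := (hL x).1 xL.
    by split; [exact: map_f|apply/exp => //; exact: KV].
  move=> [/mapP[x xK ->] ex]; apply: map_f; apply/hL; split => //.
  by apply/exp => //; exact: KV.
- by rewrite !size_map.
Qed.

Lemma active_carrier V E Y n u : active a V E Y n u -> V u.
Proof. exact: (@active_leq _ _ _ _ _ 0%N). Qed.

Lemma relabels_active V1 E1 Y1 V2 E2 Y2 p n u : relabels V1 E1 Y1 V2 E2 Y2 p ->
  V1 u -> active a V2 E2 Y2 n (p u) = active a V1 E1 Y1 n u.
Proof.
move=> iso; have [q qiso qp] := relabels_sym iso.
have [pV _ _ _ pY] := iso; have [_ _ _ _ qY] := qiso.
elim: n u => [|n IH] u Vu /=; first by rewrite pV// Vu.
rewrite IH//; congr (_ && ~~ _); apply/asboolP/asboolP => -[K [L t]].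
  exists (map q K), (map q L); rewrite -(qp u Vu).
  have [||||_] := @relabels_thin_cluster _ _ _ _ _ _ _ (active a V2 E2 Y2 n) (Y2 n)
    (active a V1 E1 Y1 n) (Y1 n) (p u) K L qiso; last exact.
  - exact: active_carrier.
  - exact: active_carrier.
  - move=> w Vw; have [_ _ pon _ _] := iso.
    by have [x Vx <-] := pon _ Vw; rewrite qp// IH.
  - exact: qY.
exists (map p K), (map p L).
have [||||_] := @relabels_thin_cluster _ _ _ _ _ _ _ (active a V1 E1 Y1 n) (Y1 n)
  (active a V2 E2 Y2 n) (Y2 n) u K L iso; last exact.
- exact: active_carrier.
- exact: active_carrier.
- exact: IH.
- exact: pY.
Qed.

Lemma relabels_retired_with V1 E1 Y1 V2 E2 Y2 p c u K L :
  relabels V1 E1 Y1 V2 E2 Y2 p -> retired_with a V1 E1 Y1 c u K L ->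
  retired_with a V2 E2 Y2 c (p u) (map p K) (map p L).
Proof.
move=> iso [t [szK szL]]; split; last by rewrite !size_map.
have [_ _ _ _ pY] := iso.
have [||||_] := @relabels_thin_cluster _ _ _ _ _ _ _ (active a V1 E1 Y1 c.1) (Y1 c.1)
  (active a V2 E2 Y2 c.1) (Y2 c.1) u K L iso; last exact.
- exact: active_carrier.
- exact: active_carrier.
- by move=> w; exact: relabels_active.
- exact: pY.
Qed.

Lemma relabels_exposed V1 E1 Y1 V2 E2 Y2 p n u :
  relabels V1 E1 Y1 V2 E2 Y2 p -> V1 u ->
  exposed E1 (active a V1 E1 Y1 n) (Y1 n) u <->
  exposed E2 (active a V2 E2 Y2 n) (Y2 n) (p u).
Proof.
move=> iso; have [_ _ _ _ pY] := iso.
(* Only the statement on exposed vertices is wanted, so empty lists are supplied. *)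
have [||||h _] := @relabels_thin_cluster _ _ _ _ _ _ _ (active a V1 E1 Y1 n) (Y1 n)
  (active a V2 E2 Y2 n) (Y2 n) u [::] [::] iso; last exact: h.
- exact: active_carrier.
- exact: active_carrier.
- by move=> w; exact: relabels_active.
- exact: pY.
Qed.

Lemma relabels_charges V1 E1 Y1 V2 E2 Y2 p c x y :
  relabels V1 E1 Y1 V2 E2 Y2 p -> V1 x -> V1 y ->
  charges a V1 E1 Y1 c x y <-> charges a V2 E2 Y2 c (p x) (p y).
Proof.
have fwd V E Y V' E' Y' r u v : relabels V E Y V' E' Y' r ->
    charges a V E Y c u v -> charges a V' E' Y' c (r u) (r v).
  move=> iso [K [L [rw [e vK]]]]; exists (map r K), (map r L).
  split; first exact: relabels_retired_with rw.
  split; last exact: map_f.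
  apply/(relabels_exposed c.1 iso) => //; apply: (retired_with_carrier rw).
  by case: rw => -[_ hK _ _ _] _; apply/hK; exact: reach_refl.
move=> iso Vx Vy; have [q qiso qp] := relabels_sym iso.
split; first exact: fwd.
by move/(fwd _ _ _ _ _ _ _ _ _ qiso); rewrite !qp.
Qed.

Lemma relabels_deleted V1 E1 Y1 V2 E2 Y2 p x :
  relabels V1 E1 Y1 V2 E2 Y2 p -> V1 x ->
  deleted a V1 E1 Y1 x <-> deleted a V2 E2 Y2 (p x).
Proof.
have fwd V E Y V' E' Y' r u : relabels V E Y V' E' Y' r -> V u ->
    deleted a V E Y u -> deleted a V' E' Y' (r u).
  move=> iso Vu /deleted_charged[c [[K [L rw]] e]].
  apply/deleted_charged; exists c; split.
    by exists (map r K), (map r L); exact: relabels_retired_with rw.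
  exact/(relabels_exposed c.1 iso).
move=> iso Vx; have [q qiso qp] := relabels_sym iso.
split; first exact: fwd.
move/(fwd _ _ _ _ _ _ _ _ qiso); rewrite qp//; apply.
by case: iso => + _ _ _ _; apply.
Qed.

Lemma deleted_carrier V E Y x : deleted a V E Y x -> V x.
Proof. by move=> [n [/retired_active/active_carrier]]. Qed.

End relabelling.

(** * Mass transport with independent vertex bits *)

Section mass_transport.
Context (R : realType) d (Omega : measurableType d) (P : probability Omega R).
Variables (M : pointedType) (X : Omega -> lgraphM M) (rho : Omega -> nat).
Local Notation vbits := (bits (nat * nat)%type).
Local Notation vfair := (fair_prob R (nat * nat)%type).
Local Open Scope ereal_scope.

Lemma measurable_fun_nat_param d' (T : measurableType d') d2 (T2 : measurableType d2)
    (r : T -> nat) (G : nat -> T -> T2) :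
  (forall n, measurable [set t | r t = n]) -> (forall n, measurable_fun setT (G n)) ->
  measurable_fun setT (fun t => G (r t) t).
Proof.
move=> mr mG _ B mB; rewrite setTI.
have -> : (fun t => G (r t) t) @^-1` B = \bigcup_n ([set t | r t = n] `&` G n @^-1` B).
  by apply/seteqP; split=> [t Bt|t [n _ [/= <-]]] //; exists (r t).
apply: bigcupT_measurable => n; apply: measurableI => //.
by rewrite -[X in measurable X]setTI; exact: mG.
Qed.

Lemma measurable_lV v : measurable ([set g | lV g v] : set (lgraphM M)).
Proof. by apply: sub_sigma_algebra; left; exists v, true. Qed.

Hypothesis mX : measurable_fun setT X.
Hypothesis mrho : forall n, measurable [set w | rho w = n].

Lemma measurable_lVX v : measurable_fun setT (fun w => lV (X w) v).
Proof.
apply: (@measurable_fun_bool _ _ _ _ true); rewrite setTI.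
have -> : (fun w => lV (X w) v) @^-1` [set true] = X @^-1` [set g | lV g v] by [].
rewrite -[X in measurable X]setTI; apply: mX => //; exact: measurable_lV.
Qed.

Lemma integral_bits_vertex_sum (H : Omega * vbits -> nat -> \bar R) :
  (forall o, measurable_fun setT (fun z => H z o)) -> (forall z o, 0 <= H z o) ->
  \int[P \x vfair]_z (\sum_(o <oo | lV (X z.1) o) H z o) =
  \int[P]_w (\sum_(o <oo | lV (X w) o) \int[vfair]_b H (w, b) o).
Proof.
move=> mH H0.
(* Extending by 0 turns the sum over a random vertex set into one over all naturals, to which
   Tonelli applies term by term. *)
pose H' o z := if lV (X z.1) o then H z o else 0.
have mH' o : measurable_fun setT (H' o).
  apply: measurable_fun_ifT => //.
  exact: (measurableT_comp (measurable_lVX o) measurable_fst).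
have H'0 o z : 0 <= H' o z by rewrite /H'; case: ifP.
transitivity (\int[P \x vfair]_z \sum_(o <oo) H' o z).
  by apply: eq_integral => z _; rewrite eseries_mkcond.
rewrite integral_nneseries//.
transitivity (\sum_(o <oo) \int[P]_w \int[vfair]_b H' o (w, b)).
  by apply: eq_eseriesr => o _; rewrite fubini_tonelli1.
transitivity (\int[P]_w \sum_(o <oo) \int[vfair]_b H' o (w, b)).
  apply/esym/integral_nneseries; first exact: measurableT.
    by move=> o; exact: (measurable_fun_fubini_tonelli_F (H' o) (mH' o) (H'0 o)).
  by move=> o w _; exact: integral_ge0.
apply: eq_integral => w _; rewrite [RHS]eseries_mkcond; apply: eq_eseriesr => o _.
by rewrite /H' /=; case: ifP => // _; rewrite integral0.
Qed.

(** Integrating out the bits leaves a function of the graph alone, which is isomorphism-invariant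
    because relabelled fair bits are fair. Unimodularity applies to it, and Tonelli puts the bits
    back. *)
Lemma mass_transport_bits (F : lgraphM M * vbits -> nat -> nat -> \bar R) :
  unimodular P X rho ->
  (forall x y, measurable_fun setT (fun z => F z x y)) ->
  (forall z x y, 0 <= F z x y) ->
  (forall g1 g2 b1 b2 p x y, lV g1 x -> lV g1 y -> liso g1 g2 p ->
     (forall n v, lV g1 v -> b1 (n, v) = b2 (n, p v)) ->
     F (g1, b1) x y = F (g2, b2) (p x) (p y)) ->
  \int[P \x vfair]_z (\sum_(o <oo | lV (X z.1) o) F (X z.1, z.2) (rho z.1) o) =
  \int[P \x vfair]_z (\sum_(o <oo | lV (X z.1) o) F (X z.1, z.2) o (rho z.1)).
Proof.
move=> uni mF F0 invF.
pose f (g : lgraphM M) x y := \int[vfair]_b F (g, b) x y.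
have tf : test_fn f.
  split.
  - move=> x y; exact: (measurable_fun_fubini_tonelli_F (fun z => F z x y) (mF x y) (fun z => F0 z x y)).
  - by move=> g x y; exact: integral_ge0.
  - move=> g1 g2 p x y gx gy iso; rewrite /f.
    pose S : pred (nat * nat) := fun i => lV g1 i.2.
    have injid : {in S &, injective (id : nat * nat -> nat * nat)} by move=> i j _ _.
    pose q (i : nat * nat) := (i.1, p i.2).
    have injq : {in S &, injective q}.
      move=> [i i'] [j j'] Si Sj [-> /= e]; congr (_, _).
      by case: iso => _ [inj _]; exact: inj.
    have mF1 : measurable_fun setT (fun b : vbits => F (g1, b) x y).
      exact: (measurableT_comp (mF x y) (pair1_measurable (g1 : lgraphM M))).
    (* By invariance under the identity, bits off the vertex set may be reset to false. Then [id] is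
       exchanged for [q], which reads the bits of [g1] from their images in [g2]. *)
    transitivity (\int[vfair]_b F (g1, reindex_bits S id b) x y).
      apply: eq_integral => b _.
      apply: (invF g1 g1 _ _ id) => //; first by do ![split=> //]; move=> w; exists w.
      by move=> n v gv; rewrite /reindex_bits /S /= gv.
    have := @fair_integral_reindex R _ S id q _ injid injq mF1.
    rewrite /fair_prob => ->//.
    apply: eq_integral => b _; apply: invF => // n v gv.
    by rewrite /reindex_bits /S /= gv.
have mFX o : measurable_fun setT (fun z : Omega * vbits => F (X z.1, z.2) (rho z.1) o)
   /\ measurable_fun setT (fun z : Omega * vbits => F (X z.1, z.2) o (rho z.1)).
  have mr n : measurable [set z : Omega * vbits | rho z.1 = n].
    rewrite -[X in measurable X]setTI.
    exact: (@measurable_fst _ _ Omega vbits measurableT _ (mrho n)).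
  have mZ : measurable_fun setT (fun z : Omega * vbits => (X z.1, z.2)).
    apply: measurable_fun_pair; last exact: measurable_snd.
    exact: (measurableT_comp mX measurable_fst).
  split.
    apply: (measurable_fun_nat_param (G := fun n z => F (X z.1, z.2) n o)) => // n.
    exact: (measurableT_comp (mF n o) mZ).
  apply: (measurable_fun_nat_param (G := fun n z => F (X z.1, z.2) o n)) => // n.
  exact: (measurableT_comp (mF o n) mZ).
pose H1 (z : Omega * vbits) o := F (X z.1, z.2) (rho z.1) o.
pose H2 (z : Omega * vbits) o := F (X z.1, z.2) o (rho z.1).
have e1 := @integral_bits_vertex_sum H1 (fun o => (mFX o).1) (fun z o => F0 _ _ _).
have e2 := @integral_bits_vertex_sum H2 (fun o => (mFX o).2) (fun z o => F0 _ _ _).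
exact: (etrans e1 (etrans (uni f tf) (esym e2))).
Qed.

End mass_transport.

Lemma nneseries_mem_seq (R : realType) (Q : pred nat) (K : seq nat) (p : nat -> Prop) :
  uniq K -> (forall i, i \in K -> Q i) -> (forall i, p i <-> i \in K) ->
  (\sum_(i <oo | Q i) (`[< p i >]%:R)%:E = (size K)%:R%:E :> \bar R)%E.
Proof.
move=> uK KQ pK.
have [N hN] : exists N, forall i, i \in K -> (i < N)%N.
  exists (\max_(i <- K) i).+1 => i iK; rewrite ltnS.
  exact: (@leq_bigmax_seq _ K xpredT id i).
rewrite (nneseries_split_cond 0 N); last by move=> i _; rewrite lee_fin.
rewrite add0n [X in (_ + X)%E]eseries0 ?adde0; last first.
  move=> i Ni _ /=; case: asboolP => // /pK/hN; lia.
rewrite sumEFin -natr_sum; congr (_%:R%:E).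
transitivity (\sum_(0 <= i < N | i \in K) 1)%N.
  rewrite big_mkcond [RHS]big_mkcond; apply: eq_bigr => i _ /=.
  have -> : `[< p i >] = (i \in K) by apply/asboolP/idP => /pK.
  case: ifP => [|/negbT Qi]; first by case: (i \in K).
  by case: ifP => // /KQ; rewrite (negbTE Qi).
rewrite sum1_count -size_filter; apply: perm_size; apply: uniq_perm => //.
  by rewrite filter_uniq// iota_uniq.
move=> i; rewrite mem_filter mem_iota /=; case iK : (i \in K) => //=.
by rewrite subn0 hN.
Qed.

(** * The thinned random graph *)

Section measurable_charges.
Context d (T : measurableType d) (R : realType) (a : R).
Variables (V : T -> pred nat) (E : T -> rel nat) (Y : T -> nat -> pred nat).
Hypothesis mV : forall v, measurable [set t | V t v].
Hypothesis mE : forall u v, measurable [set t | E t u v].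
Hypothesis mY : forall n v, measurable [set t | Y t n v].

Lemma measurable_retired_with c x K L :
  measurable [set t | retired_with a (V t) (E t) (Y t) c x K L].
Proof.
apply: measurable_and; last exact: measurable_cst_prop.
by apply: measurable_thin_cluster => // v; exact: measurable_active.
Qed.

Lemma measurable_active_exposed n x :
  measurable [set t | exposed (E t) (active a (V t) (E t) (Y t) n) (Y t n) x].
Proof. by apply: measurable_exposed => // v; exact: measurable_active. Qed.

Lemma measurable_charged c x : measurable [set t | charged a (V t) (E t) (Y t) c x].
Proof.
by do 2 apply: measurable_exists => ?; exact: measurable_retired_with.
Qed.

Lemma measurable_charged_exposed c x :
  measurable [set t | charged_exposed a (V t) (E t) (Y t) c x].
Proof.
by apply: measurable_and; [exact: measurable_charged|exact: measurable_active_exposed].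
Qed.

Lemma measurable_charges c x y :
  measurable [set t | charges a (V t) (E t) (Y t) c x y].
Proof.
do 2 apply: measurable_exists => ?.
apply: measurable_and; first exact: measurable_retired_with.
by apply: measurable_and; [exact: measurable_active_exposed|exact: measurable_cst_prop].
Qed.

End measurable_charges.

Section thinning.
Variables (R : realType) (a : R).
Local Notation vbits := (bits (nat * nat)%type).
Implicit Types (g : lgraph bool) (b : vbits).

Definition open_vertex g : pred nat := fun v => lV g v && lvm g v.
Definition open_edge g : rel nat := fun u v => ladj g u v && Defs.lem g u v.
Definition stage_bit b n : pred nat := fun v => b (n, v).

Definition removed g b v : Prop :=
  deleted a (open_vertex g) (open_edge g) (stage_bit b) v.

(* Test functions must be invariant under [liso] even on ill-formed graphs,
   where [ladj] may hold outside [lV]; hence the conditions on [u] and [v]. *)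
Definition thinned g b : lgraph (bool * bool) :=
  LGraph (lV g) (fun u v => [&& ladj g u v, lV g u & lV g v])
    (fun v => (lvm g v, ~~ `[< removed g b v >]))
    (fun u v => (Defs.lem g u v, ~~ `[< removed g b u >] && ~~ `[< removed g b v >])).

Lemma liso_relabels g1 g2 b1 b2 p : liso g1 g2 p ->
  (forall n v, lV g1 v -> b1 (n, v) = b2 (n, p v)) ->
  relabels (open_vertex g1) (open_edge g1) (stage_bit b1)
           (open_vertex g2) (open_edge g2) (stage_bit b2) p.
Proof.
move=> [pV [pinj [pon [padj [pvm pem]]]]] pb; split.
- by move=> u /andP[Vu mu]; rewrite /open_vertex pV// pvm.
- by move=> u v /andP[Vu _] /andP[Vv _]; exact: pinj.
- move=> w /andP[/pon[u [Vu <-]]]; rewrite pvm// => mu; exists u => //.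
  by rewrite /open_vertex Vu.
- move=> u v /andP[Vu _] /andP[Vv _]; rewrite /open_edge padj//.
  by case uv: (ladj g1 u v) => //=; rewrite pem.
- by move=> n u /andP[Vu _]; rewrite /stage_bit -pb.
Qed.

Lemma liso_open_vertex g1 g2 p v : liso g1 g2 p -> lV g1 v ->
  open_vertex g2 (p v) = open_vertex g1 v.
Proof.
by move=> [pV [_ [_ [_ [pvm _]]]]] Vv; rewrite /open_vertex pV// pvm// Vv.
Qed.

Lemma liso_removed g1 g2 b1 b2 p v : liso g1 g2 p ->
  (forall n v, lV g1 v -> b1 (n, v) = b2 (n, p v)) -> lV g1 v ->
  removed g1 b1 v <-> removed g2 b2 (p v).
Proof.
move=> iso pb Vv; have rel := liso_relabels iso pb.
have eV := liso_open_vertex iso Vv.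
case Ov : (open_vertex g1 v); first exact: relabels_deleted rel Ov.
by split=> /deleted_carrier; rewrite ?eV Ov.
Qed.

Lemma liso_charges g1 g2 b1 b2 p c x y : liso g1 g2 p ->
  (forall n v, lV g1 v -> b1 (n, v) = b2 (n, p v)) -> lV g1 x -> lV g1 y ->
  charges a (open_vertex g1) (open_edge g1) (stage_bit b1) c x y <->
  charges a (open_vertex g2) (open_edge g2) (stage_bit b2) c (p x) (p y).
Proof.
move=> iso pb Vx Vy; have rel := liso_relabels iso pb.
have carrier V E Y u v : charges a V E Y c u v -> V u && V v.
  move=> [K [L [rw [_ vK]]]]; rewrite (retired_with_carrier rw vK) andbT.
  by case: rw => -[/andP[Au _] _ _ _ _] _; exact: active_carrier Au.
case Oxy : (open_vertex g1 x && open_vertex g1 y).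
  by move/andP : Oxy => [Ox Oy]; exact: relabels_charges.
split=> /carrier; first by rewrite Oxy.
by rewrite !(liso_open_vertex iso)// Oxy.
Qed.

Lemma liso_thinned g1 g2 b1 b2 p : liso g1 g2 p ->
  (forall n v, lV g1 v -> b1 (n, v) = b2 (n, p v)) ->
  liso (thinned g1 b1) (thinned g2 b2) p.
Proof.
move=> iso pb.
have rm v : lV g1 v -> `[< removed g2 b2 (p v) >] = `[< removed g1 b1 v >].
  by move=> Vv; apply/asboolP/asboolP => /(liso_removed iso pb Vv).
have [pV [pinj [pon [padj [pvm pem]]]]] := iso.
do ![split => //=].
- by move=> u v Vu Vv; rewrite padj// !pV// Vu Vv.
- by move=> u Vu; rewrite pvm// rm.
- by move=> u v /and3P[uv Vu Vv]; rewrite pem// !rm.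
Qed.

Lemma Hv_thinned g b :
  Hv (thinned g b) = kept a (open_vertex g) (open_edge g) (stage_bit b).
Proof. by apply/funext => v; rewrite /Hv /kept /open_vertex /= andbA. Qed.

Lemma He_thinned g b :
  He (thinned g b) = kept_edge a (open_vertex g) (open_edge g) (stage_bit b).
Proof.
apply/funext => u; apply/funext => v.
rewrite /He /kept_edge Hv_thinned /= /kept /open_vertex /open_edge /removed.
case: (lV g u) => //=; case: (lvm g u) => //=; case: `[< _ >] => //=.
case: (lV g v) => //=; case: (lvm g v) => //=; case: `[< _ >] => //=.
by rewrite !andbT.
Qed.

Lemma thinned_expansion g b v : symmetric (open_edge g) ->
  (forall u, exists n, forall w, ladj g u w -> (w < n)%N) ->
  (forall (s t : seq nat) N, exists2 n, (N <= n)%N & forall w, w \in t -> b (n, w) = (w \in s)) ->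
  ~ finite_set (Hcomp (thinned g b) v) ->
  inner_expansion_ge (thinned g b) (Hcomp (thinned g b) v) a.
Proof.
move=> Esym fin gen.
rewrite /inner_expansion_ge /Hcomp Hv_thinned He_thinned => inf K uK Kn KC.
rewrite ler_pdivlMr; last by rewrite ltr0n lt0n size_eq0.
apply: (expansion (E := open_edge g) (Y := stage_bit b) _ _ _ inf) => //.
by move=> u; have [n hn] := fin u; exists n => w /andP[/hn].
Qed.

Local Notation graph_bits := (lgraphM bool * vbits)%type.

Lemma measurable_graph (A : set (lgraph bool)) : lcyl A ->
  measurable [set z : graph_bits | A z.1].
Proof.
move=> hA; rewrite -[X in measurable X]setTI.
apply: (@measurable_fst _ _ (lgraphM bool) vbits measurableT _ _).
exact: sub_sigma_algebra.
Qed.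

Lemma measurable_graph_lV v : measurable [set z : graph_bits | lV z.1 v].
Proof. by apply: (measurable_graph (A := [set g | lV g v])); left; exists v, true. Qed.

Lemma measurable_graph_ladj u v : measurable [set z : graph_bits | ladj z.1 u v].
Proof.
by apply: (measurable_graph (A := [set g | ladj g u v])); right; left; exists u, v, true.
Qed.

Lemma measurable_graph_lvm v : measurable [set z : graph_bits | lvm z.1 v].
Proof.
by apply: (measurable_graph (A := [set g : lgraph bool | lvm g v])); right; right; left; exists v, true.
Qed.

Lemma measurable_graph_lem u v : measurable [set z : graph_bits | Defs.lem z.1 u v].
Proof.
by apply: (measurable_graph (A := [set g : lgraph bool | Defs.lem g u v])); right; right; right; exists u, v, true.
Qed.

Lemma measurable_open_vertex v : measurable [set z : graph_bits | open_vertex z.1 v].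
Proof.
by apply: measurable_andb; [exact: measurable_graph_lV|exact: measurable_graph_lvm].
Qed.

Lemma measurable_open_edge u v : measurable [set z : graph_bits | open_edge z.1 u v].
Proof.
by apply: measurable_andb; [exact: measurable_graph_ladj|exact: measurable_graph_lem].
Qed.

Lemma measurable_stage_bit n v : measurable [set z : graph_bits | stage_bit z.2 n v].
Proof.
rewrite -[X in measurable X]setTI.
apply: (@measurable_snd _ _ (lgraphM bool) vbits measurableT [set b : vbits | b (n, v)]).
exact: (measurable_bit (I := (nat * nat)%type) (n, v) true).
Qed.

Lemma measurable_removed v : measurable [set z : graph_bits | removed z.1 z.2 v].
Proof.
apply: measurable_deleted; [exact: measurable_open_vertex|exact: measurable_open_edge|].
exact: measurable_stage_bit.
Qed.

Lemma measurable_kept v :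
  measurable [set z : graph_bits | ~~ `[< removed z.1 z.2 v >]].
Proof. by apply/measurable_negb/measurable_asbool; exact: measurable_removed. Qed.

Lemma measurable_bool_eq d (T : measurableType d) (q : T -> bool) c :
  measurable [set t | q t] -> measurable [set t | q t = c].
Proof.
case: c => // mq; have -> : [set t | q t = false] = [set t | ~~ q t].
  by apply/seteqP; split=> t /=; case: (q t).
exact: measurable_negb.
Qed.

Lemma measurable_thinned :
  measurable_fun setT (fun z : graph_bits => thinned z.1 z.2 : lgraphM (bool * bool)%type).
Proof.
apply: (@measurability _ _ _ (lgraphM (bool * bool)%type) _ _ (@lcyl (bool * bool)%type)) => //.
move=> _ [A hA <-]; rewrite setTI.
have mpair (q q' : graph_bits -> bool) (c : bool * bool) :
    measurable [set z | q z] -> measurable [set z | q' z] ->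
    measurable [set z | (q z, q' z) = c].
  move=> mq mq'; have -> : [set z | (q z, q' z) = c] = [set z | q z = c.1 /\ q' z = c.2].
    apply/seteqP; split=> z /=; first by move=> <-.
    by case: c => c1 c2 /= [-> ->].
  by apply: measurable_and; exact: measurable_bool_eq.
case: hA => [[i [c ->]]|[[i [j [c ->]]]|[[i [m ->]]|[i [j [m ->]]]]]] /=.
- by apply: measurable_bool_eq; exact: measurable_graph_lV.
- apply: measurable_bool_eq; apply: measurable_andb; first exact: measurable_graph_ladj.
  by apply: measurable_andb; exact: measurable_graph_lV.
- by apply: mpair; [exact: measurable_graph_lvm|exact: measurable_kept].
- apply: mpair; first exact: measurable_graph_lem.
  by apply: measurable_andb; exact: measurable_kept.
Qed.

End thinning.

(** * The random thinned graph: unimodularity, law, rate and expansion *)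

Section thinned_process.
Context (R : realType) d (Omega : measurableType d) (P : probability Omega R).
Variables (X : Omega -> lgraphM bool) (rho : Omega -> nat) (a : R).
Local Notation vbits := (bits (nat * nat)%type).
Local Notation vfair := (fair_prob R (nat * nat)%type).
Local Notation P' := (P \x vfair)%E.

Hypothesis rrX : random_rooted X rho.
Hypothesis uniX : unimodular P X rho.
Hypothesis a0 : 0 < a.

Let mX : measurable_fun setT X. Proof. by case: rrX. Qed.
Let mrho n : measurable [set w | rho w = n]. Proof. by case: rrX. Qed.
Let wfX w : wf_rooted (X w) (rho w). Proof. by case: rrX. Qed.

Definition thinned_graph (z : Omega * vbits) : lgraphM (bool * bool)%type :=
  thinned a (X z.1) z.2.

Lemma measurable_graph_and_bits :
  measurable_fun setT (fun z : Omega * vbits => (X z.1, z.2)).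
Proof.
apply: measurable_fun_pair; last exact: measurable_snd.
exact: (measurableT_comp mX measurable_fst).
Qed.

Lemma measurable_root n : measurable [set z : Omega * vbits | rho z.1 = n].
Proof.
rewrite -[X in measurable X]setTI.
exact: (@measurable_fst _ _ Omega vbits measurableT _ (mrho n)).
Qed.

Lemma measurable_at_root (Q : lgraphM bool * vbits -> nat -> Prop) :
  (forall v, measurable [set z | Q z v]) ->
  measurable [set z : Omega * vbits | Q (X z.1, z.2) (rho z.1)].
Proof.
move=> mQ; have -> : [set z : Omega * vbits | Q (X z.1, z.2) (rho z.1)] =
    [set z | exists n, rho z.1 = n /\ Q (X z.1, z.2) n].
  by apply/seteqP; split=> z /= => [h|[n [-> //]]]; exists (rho z.1).
apply: measurable_exists => n; apply: measurable_and; first exact: measurable_root.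
have := measurable_graph_and_bits measurableT (mQ n).
by rewrite setTI.
Qed.

Lemma open_edge_sym w : symmetric (open_edge (X w)).
Proof.
have [_ [_ [adjC [_ [lemC _]]]]] := wfX w.
move=> u v; rewrite /open_edge (adjC v u).
by case uv: (ladj (X w) u v) => //=; rewrite lemC.
Qed.

Lemma thinned_graph_random_rooted : random_rooted thinned_graph (rho \o fst).
Proof.
split.
- exact: (measurableT_comp (measurable_thinned a) measurable_graph_and_bits).
- exact: measurable_root.
- move=> [w b] /=; have [Vr [adjV [adjC [irr [lemC [fin con]]]]]] := wfX w.
  have adjE u v : [&& ladj (X w) u v, lV (X w) u & lV (X w) v] = ladj (X w) u v.
    by case uv: (ladj _ u v) => //=; exact: adjV uv.
  split=> //=; split; first by move=> u v /and3P[_ -> ->].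
  split; first by move=> u v; rewrite !adjE.
  split; first by move=> u; rewrite adjE.
  split; first by move=> u v; rewrite adjE => uv; rewrite lemC// andbC.
  split; first by move=> u; have [n hn] := fin u; exists n => v; rewrite adjE; exact: hn.
  by move=> v Vv; apply: sub_reach (con v Vv) => x y; rewrite adjE.
Qed.

(** A test function of the thinned graph is an invariant function of the original graph with its
    bits. *)
Lemma thinned_graph_unimodular : unimodular P' thinned_graph (rho \o fst).
Proof.
move=> f [mf f0 finv].
apply: (mass_transport_bits (F := fun z x y => f (thinned a z.1 z.2) x y) mX mrho uniX).
- move=> x y.
  exact: (measurableT_comp (f := fun g => f g x y) (mf x y) (measurable_thinned a)).
- by move=> z x y; exact: f0.
- move=> g1 g2 b1 b2 p x y Vx Vy iso pb; apply: finv => //.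
  exact: liso_thinned.
Qed.

Lemma thinned_graph_same_law :
  same_law P P' X rho (fun z => proj1_marks (thinned_graph z)) (rho \o fst).
Proof.
move=> f [mf f0 finv].
(* An equality of labelled graphs: well-formedness already puts the endpoints of each edge in the
   vertex set. The bits then integrate out with total mass 1. *)
have projX z : proj1_marks (thinned_graph z) = X z.1.
  rewrite /proj1_marks /thinned_graph /=.
  have [_ [adjV _]] := wfX z.1; move: adjV.
  case: (X z.1) => V A vm em /= adjV; congr LGraph.
  apply/funext => u; apply/funext => v.
  by case uv: (A u v) => //=; exact: adjV uv.
have mfr : measurable_fun setT (fun w => f (X w) (rho w) (rho w)).
  apply: (measurable_fun_nat_param (G := fun n w => f (X w) n n) mrho) => n.
  exact: (measurableT_comp (f := fun g => f g n n) (mf n n) mX).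
pose h (z : Omega * vbits) := f (X z.1) (rho z.1) (rho z.1).
have mh : measurable_fun setT h.
  exact: (measurableT_comp (f := fun w => f (X w) (rho w) (rho w)) mfr measurable_fst).
transitivity (\int[P']_z h z)%E; last first.
  by apply: eq_integral => z _; rewrite /h /= projX.
rewrite fubini_tonelli1//; last by move=> z; exact: f0.
apply: eq_integral => w _; rewrite /fubini_F /h /= integral_cst//.
by rewrite [X in (_ * X)%E](_ : _ = 1%E) ?mule1//; exact: fair_setT.
Qed.

Local Notation rooted_event Q c :=
  [set z : Omega * vbits | Q a (open_vertex (X z.1)) (open_edge (X z.1))
     (stage_bit z.2) c (rho z.1)].

Lemma measurable_charged_at_root c : measurable (rooted_event (@charged R) c).
Proof.
apply: (measurable_at_root (Q := fun z v => charged a (open_vertex z.1)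
  (open_edge z.1) (stage_bit z.2) c v)) => v.
apply: measurable_charged; [exact: measurable_open_vertex|exact: measurable_open_edge|].
exact: measurable_stage_bit.
Qed.

Lemma measurable_charged_exposed_at_root c :
  measurable (rooted_event (@charged_exposed R) c).
Proof.
apply: (measurable_at_root (Q := fun z v => charged_exposed a (open_vertex z.1)
  (open_edge z.1) (stage_bit z.2) c v)) => v.
apply: measurable_charged_exposed; [exact: measurable_open_vertex|exact: measurable_open_edge|].
exact: measurable_stage_bit.
Qed.

(** Mass transport for a single code: the left side is the expected mass sent by the root, the right
    side the expected mass it receives. *)
Lemma charge_balance c :
  (c.2.1%:R%:E * P' (rooted_event (@charged_exposed R) c) =
   c.2.2%:R%:E * P' (rooted_event (@charged R) c))%E.
Proof.
pose F (z : lgraphM bool * vbits) x y : \bar R := (`[< charges a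
  (open_vertex z.1) (open_edge z.1) (stage_bit z.2) c x y >]%:R)%:E.
have mF x y : measurable_fun setT (fun z => F z x y).
  pose A : set (lgraphM bool * vbits) := [set z | charges a
    (open_vertex z.1) (open_edge z.1) (stage_bit z.2) c x y].
  have mA : measurable A.
    apply: measurable_charges; [exact: measurable_open_vertex|exact: measurable_open_edge|].
    exact: measurable_stage_bit.
  have -> : (fun z => F z x y) = EFin \o \1_A.
    apply/funext => z; rewrite /F /= indicE.
    by case: asboolP => h; [rewrite mem_set|rewrite memNset].
  by apply/measurable_EFinP; exact: measurable_indic.
have F0 z x y : (0 <= F z x y)%E by rewrite lee_fin.
have Finv g1 g2 b1 b2 p x y : lV g1 x -> lV g1 y -> liso g1 g2 p ->
    (forall n v, lV g1 v -> b1 (n, v) = b2 (n, p v)) ->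
    F (g1, b1) x y = F (g2, b2) (p x) (p y).
  move=> Vx Vy iso pb; rewrite /F; congr ((nat_of_bool _)%:R%:E).
  by apply/asboolP/asboolP => /(liso_charges _ c iso pb Vx Vy).
have mtp := mass_transport_bits mX mrho uniX mF F0 Finv.
have weight (k : nat) (D : set (Omega * vbits)) : measurable D ->
    (k%:R%:E * P' D = \int[P']_z (k%:R%:E * (\1_D z)%:E))%E.
  move=> mD; rewrite ge0_integralZl_EFin; last by rewrite ler0n.
  - by rewrite (integral_indic _ measurableT mD) setIT.
  - exact: measurableT.
  - by move=> z _; rewrite lee_fin.
  - by apply/measurable_EFinP; exact: measurable_indic.
have sizeE (k : nat) (Q : Prop) (D : set (Omega * vbits)) z : (D z <-> Q) ->
    (if `[< Q >] then k else 0%N)%:R%:E = (k%:R%:E * (\1_D z)%:E : \bar R)%E.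
  move=> DQ; rewrite indicE -EFinM; case: asboolP => hQ.
    by rewrite mem_set ?mulr1//; apply/DQ.
  by rewrite memNset ?mulr0//; apply/DQ.
rewrite !weight; [|exact: measurable_charged_at_root|exact: measurable_charged_exposed_at_root].
have OV w v : open_vertex (X w) v -> lV (X w) v by case/andP.
transitivity (\int[P']_z (\sum_(o <oo | lV (X z.1) o) F (X z.1, z.2) (rho z.1) o))%E.
  apply: eq_integral => z _.
  have [K [uK KV hK szK]] := charges_out a (open_vertex (X z.1)) (open_edge (X z.1))
    (stage_bit z.2) c (rho z.1).
  rewrite (nneseries_mem_seq R uK (fun i iK => OV _ _ (KV i iK)) hK).
  by rewrite szK; apply/esym/sizeE.
rewrite mtp; apply: eq_integral => z _.
have [L [uL LV hL szL]] := charges_in a (open_vertex (X z.1)) (stage_bit z.2) c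
  (rho z.1) (open_edge_sym z.1).
rewrite (nneseries_mem_seq R uL (fun i iL => OV _ _ (LV i iL)) hL).
by rewrite szL; apply: sizeE.
Qed.

(** Write the code's cluster size as $k$ and its exposed count as $l$. If $l < ak$, then $k>0$ and
    the balance can be divided by $k$; otherwise no cluster with this code retires and the left side
    is 0. *)
Lemma charged_exposed_le c :
  (P' (rooted_event (@charged_exposed R) c) <= a%:E * P' (rooted_event (@charged R) c))%E.
Proof.
have bal := charge_balance c.
have mD := measurable_charged_exposed_at_root c.
have mT := measurable_charged_at_root c.
set D := rooted_event (@charged_exposed R) c in bal mD *.
set T := rooted_event (@charged R) c in bal mT *.
have [bad|good] := ltP (c.2.2%:R : R) (a * c.2.1%:R); last first.
  have -> : D = set0.
    by apply/seteqP; split=> // z [/charged_bad bad _]; move: good; rewrite leNgt bad.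
  by rewrite measure0 mule_ge0// lee_fin ltW.
have k0 : 0 < c.2.1%:R :> R.
  rewrite -(pmulr_rgt0 _ a0); apply: le_lt_trans bad; exact: ler0n.
have fin (A : set (Omega * vbits)) : measurable A -> P' A \is a fin_num.
  move=> mA; rewrite ge0_fin_numE ?measure_ge0//.
  exact: le_lt_trans (probability_le1 P'%E mA) (ltry _).
have finD := fin D mD; have finT := fin T mT.
move: bal; rewrite -(fineK finD) -(fineK finT) -!EFinM lee_fin => -[bal].
rewrite -(ler_pM2l k0) bal mulrA; apply: ler_wpM2r; first exact: fine_ge0.
by rewrite [X in _ <= X]mulrC ltW.
Qed.

(** Sum [charged_exposed_le] over all codes: the root is deleted under some code, and the events
    that it retires with a given code are disjoint, so their probabilities add up to at most 1. *)
Lemma thinned_graph_rate :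
  (P' [set z | ~~ (lvm (thinned_graph z) ((rho \o fst) z)).2] <= a%:E)%E.
Proof.
(* [unpickle] need not be injective, so it would not give disjoint events. *)
pose at_code (G : nat * (nat * nat) -> set (Omega * vbits)) m :=
  if pickle_inv m is Some c then G c else set0.
pose D := at_code (fun c => rooted_event (@charged_exposed R) c).
pose T := at_code (fun c => rooted_event (@charged R) c).
have mD m : measurable (D m).
  by rewrite /D /at_code; case: pickle_inv => // c; exact: measurable_charged_exposed_at_root.
have mT m : measurable (T m).
  by rewrite /T /at_code; case: pickle_inv => // c; exact: measurable_charged_at_root.
have -> : [set z | ~~ (lvm (thinned_graph z) ((rho \o fst) z)).2] = \bigcup_m D m.
  apply/seteqP; split=> z /=.
    rewrite negbK => /asboolP/deleted_charged[c hc].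
    by exists (pickle c) => //; rewrite /D /at_code pickleK_inv.
  move=> [m _]; rewrite /D /at_code; case: pickle_inv => // c hc.
  by rewrite negbK; apply/asboolP/deleted_charged; exists c.
have tT : trivIset setT T.
  apply/trivIsetP => m n _ _ mn; apply/seteqP; split=> // z [].
  rewrite /T /at_code.
  case em : (pickle_inv m) => [c|//]; case en : (pickle_inv n) => [c'|//] h h'.
  move: mn; have := @pickle_invK (nat * (nat * nat))%type m.
  have := @pickle_invK (nat * (nat * nat))%type n; rewrite em en /= => <- <-.
  by rewrite (charged_once h h') eqxx.
apply: (@le_trans _ _ (\sum_(m <oo) P' (D m))%E).
  by apply: measure_sigma_subadditive => //; exact: bigcupT_measurable.
apply: (@le_trans _ _ (\sum_(m <oo) (a%:E * P' (T m)))%E).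
  apply: lee_nneseries => // m _.
  rewrite /D /T /at_code; case: pickle_inv => [c|]; first exact: charged_exposed_le.
  by rewrite measure0 mule0.
rewrite nneseriesZl//.
rewrite -measure_semi_bigcup//; last exact: bigcupT_measurable.
rewrite -[leRHS]mule1; apply: lee_wpmul2l; first by rewrite lee_fin ltW.
by apply: probability_le1; exact: bigcupT_measurable.
Qed.

Lemma negligible_snd (A : set vbits) : vfair.-negligible A ->
  P'.-negligible [set z | A z.2].
Proof.
move=> [B [mB B0 AB]]; exists (setT `*` B); split.
- exact: measurableX.
- by rewrite /= product_measure1E// [X in (_ * X)%E](_ : _ = 0%E) ?mule0//; exact: B0.
- by move=> z Az; split=> //; exact: AB.
Qed.

Lemma stage_bits_recurrent :
  {ae P', forall z, forall (s t : seq nat) N,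
    exists2 n, (N <= n)%N & forall w, w \in t -> z.2 (n, w) = (w \in s)}.
Proof.
pose bad (q : seq nat * (seq nat * nat)) : set vbits :=
  [set b | forall n, (q.2.2 <= n)%N -> ~ forall w, w \in q.2.1 -> b (n, w) = (w \in q.1)].
have bad0 q : vfair.-negligible (bad q).
  case: q => s [t N].
  (* One block per stage from [N] on: distinct stages use distinct bits, so the blocks are disjoint
     and all have the same size. *)
  pose tt n : seq (nat * nat) := [seq ((N + n)%N, w) | w <- undup t].
  apply: negligibleS (@fair_recurrent R _ tt (size (undup t)) (fun i => i.2 \in s) _ _).
  - move=> b hb n hn; apply: (hb (N + n)%N); first exact: leq_addr.
    by move=> w wt; apply: (hn (_, w)); apply: map_f; rewrite mem_undup.
  - move=> n; rewrite size_map map_inj_uniq ?undup_uniq//.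
    by move=> u v [].
  - move=> n n' i /mapP[u _ ->] /mapP[v _ [/eqP]].
    by rewrite eqn_add2l => /eqP.
pose B m : set (Omega * vbits) :=
  if unpickle m is Some q then [set z | bad q z.2] else set0.
apply: (@negligibleS _ _ _ _ (\bigcup_m B m)); last first.
  apply: negligible_bigcup => m; rewrite /B; case: unpickle => [q|].
    exact: negligible_snd.
  exact: negligible_set0.
move=> z /= /existsNP[s /existsNP[t /existsNP[N hN]]].
exists (pickle (s, (t, N))) => //; rewrite /B pickleK => n Nn hn.
by apply: hN; exists n.
Qed.

(** Expansion is deterministic once all bit patterns recur, so the exceptional set lies in that of
    [stage_bits_recurrent]. *)
Lemma thinned_graph_expansion :
  {ae P', forall z, forall v, Hv (thinned_graph z) v ->
    ~ finite_set (Hcomp (thinned_graph z) v) ->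
    inner_expansion_ge (thinned_graph z) (Hcomp (thinned_graph z) v) a}.
Proof.
apply: negligibleS stage_bits_recurrent => z; apply: contra_not => gen v _.
apply: thinned_expansion => //; first exact: open_edge_sym.
by case: (wfX z.1) => _ [_ [_ [_ [_ []]]]].
Qed.

End thinned_process.

Unset Implicit Arguments.

Theorem theorem4p1 (R : realType) (d : measure_display)
  (Omega : measurableType d) (P : probability Omega R)
  (X : Omega -> lgraphM bool) (rho : Omega -> nat) (D : nat)
  (HD : (0 < D)%N)
  (Hrrg : random_rooted X rho)
  (Hunimod : unimodular P X rho)
  (Hperc : {ae P, forall w, is_percolation (X w)})
  (Hdeg : {ae P, forall w, perc_deg_le (X w) D})
  (alpha : R) (Halpha : 0 < alpha) :
  exists (d' : measure_display) (Omega' : measurableType d')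
         (P' : probability Omega' R)
         (X' : Omega' -> lgraphM (bool * bool)%type) (rho' : Omega' -> nat),
    random_rooted X' rho' /\
    unimodular P' X' rho' /\
    same_law P P' X rho (fun w => proj1_marks (X' w)) rho' /\
    {ae P', forall w, is_site_percolation2 (X' w)} /\
    (P' [set w | ~~ (lvm (X' w) (rho' w)).2] <= alpha%:E)%E /\
    {ae P', forall w, forall v, Hv (X' w) v ->
            ~ finite_set (Hcomp (X' w) v) ->
            inner_expansion_ge (X' w) (Hcomp (X' w) v) alpha}.
Proof.
(* The probability space is enlarged by an independent fair bit for each pair of a stage and a
   vertex. *)
exists _, (Omega * bits (nat * nat)%type)%type, (P \x fair_prob R (nat * nat)%type)%E.
exists (thinned_graph X alpha), (rho \o fst).
split; first exact: thinned_graph_random_rooted.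
split; first exact: thinned_graph_unimodular.
split; first exact: (thinned_graph_same_law P alpha Hrrg).
(* The second edge mark was defined as the conjunction of the endpoint marks. *)
split; first by apply: aeW => z u v _.
split; first exact: thinned_graph_rate.
exact: (thinned_graph_expansion P alpha Hrrg).
Qed.
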